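(* Let $P=\{x\in\mathbb{R}^d : a\ge Ax\}$ be a nonempty polytope, let $Q=\{(x,y')\in\mathbb{R}^{d+n} : b\ge Bx+B'y'\}$ be a nonempty polyhedron with $b\in\mathbb{R}^q$, and let $\pi(Q)\subseteq\mathbb{R}^d$ be the projection of $Q$ to the $x$-coordinates. Let $\Delta^q=\{z\in\mathbb{R}^q : \mathbf{1}^Tz=1,\ z\ge 0\}$ and suppose that $K:=\ker(B'^T)\cap\Delta^q\ne\emptyset$. Assume that every optimal solution $(x,z)$ of the bilinear program $$\min\{z^T(b-Bx) : (x,z)\in P\times K\}$$ is a pair consisting of a vertex of $P$ and a vertex of $K$. Then the sum-of-squares hierarchy decides the containment $P\subseteq\pi(Q)$ in finitely many steps: with $f_t$ the $t$-th value of the hierarchy (see context) for the equivalent problem of maximizing $f(x,z)=-z^T(b-Bx)$ over $P\times K$, there is $t_0\ge 2$ such that for every $t\ge t_0$, $P\subseteq\pi(Q)$ holds if and only if $f_t\le 0$.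
   Context: $\mathbf{1}$ is the all-ones vector and inequalities between vectors are componentwise. The hierarchy: put $P_1=P$ (variables $x_1=x\in\mathbb{R}^{d_1}$, $d_1=d$) and $P_2=K$ (variables $x_2=z\in\mathbb{R}^{d_2}$, $d_2=q$), given by representations $P_i=\{x_i\in\mathbb{R}^{d_i} : a^{(i)}\ge A^{(i)}x_i,\ b^{(i)}=B^{(i)}x_i\}$ with $a^{(i)}\in\mathbb{R}^{m_i}$, $b^{(i)}\in\mathbb{R}^{n_i}$. Standing assumption on the representations: for $i=1,2$, with $\mathcal{B}_i=\{x\in\mathbb{R}^{d_i} : b^{(i)}=B^{(i)}x\}$, the equality constraints are linearly independent, i.e. $\dim\mathcal{B}_i=d_i-n_i$, with $d_i-n_i>0$, and $P_i$ is full-dimensional in $\mathcal{B}_i$, i.e. $\dim P_i=d_i-n_i$. Let $\mathbb{R}[x,z]$ be the polynomial ring in all variables, $\Sigma_k$ the set of sums of squares of polynomials of degree at most $k$, and $\mathbb{R}_k$ the set of polynomials of degree at most $k$. For $t\ge 2$ define $$\mathrm{QM}_t=\Big\{\sigma_0+\sum_{i=1}^2\sum_{j=1}^{m_i}\sigma_{ij}(a^{(i)}-A^{(i)}x_i)_j : \sigma_0\in\Sigma_{2t},\ \sigma_{ij}\in\Sigma_{2t-2}\Big\},\quad \mathrm{I}_t=\Big\{\sum_{i=1}^2\sum_{j=1}^{n_i}\tau_{ij}(b^{(i)}-B^{(i)}x_i)_j : \tau_{ij}\in\mathbb{R}_{2t-1}\Big\},$$ and $f_t=\inf\{\mu\in\mathbb{R}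 : \mu-f\in\mathrm{QM}_t+\mathrm{I}_t\}$ (with $\inf\emptyset=+\infty$). *)

(* Defs.v *)
From HB Require Import structures.
From mathcomp Require Import all_boot all_order all_algebra.
From mathcomp Require Import mpoly.
From mathcomp Require Import boolp classical_sets reals constructive_ereal ereal.

Set Implicit Arguments.
Unset Strict Implicit.
Unset Printing Implicit Defensive.

Import Order.TTheory GRing.Theory Num.Theory.

Local Open Scope classical_set_scope.
Local Open Scope ring_scope.

Section Polyhedra.
Variable R : realType.

Definition lev (k : nat) (u v : 'cV[R]_k) : Prop := forall i, u i 0 <= v i 0.

Definition polyhedron (d m : nat) (A : 'M[R]_(m, d)) (a : 'cV[R]_m) :
    set 'cV[R]_d :=
  [set x | lev (A *m x) a].

Definition bounded (d : nat) (S : set 'cV[R]_d) : Prop :=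
  exists M : R, forall x, S x -> forall i, `|x i 0| <= M.

(* A zero-dimensional face: the linear functional [x |-> c x] attains its
   maximum over [S] exactly at [v]. *)
Definition vertex (d : nat) (S : set 'cV[R]_d) (v : 'cV[R]_d) : Prop :=
  S v /\ exists c : 'rV[R]_d,
    forall x, S x -> x <> v -> (c *m x) 0 0 < (c *m v) 0 0.

Definition aff_hull (d : nat) (S : set 'cV[R]_d) : set 'cV[R]_d :=
  [set v | exists (k : nat) (p : 'I_k -> 'cV[R]_d) (l : 'I_k -> R),
     [/\ forall i, S (p i), \sum_i l i = 1 & v = \sum_i l i *: p i]].

(* [S] is nonempty and its affine hull is a translate of a [k]-dimensional
   linear subspace. *)
Definition has_dim (d : nat) (S : set 'cV[R]_d) (k : nat) : Prop :=
  exists (x0 : 'cV[R]_d) (L : {vspace 'cV[R]_d}),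
    \dim L = k /\ forall v, aff_hull S v <-> v - x0 \in L.

Definition simplex (q : nat) : set 'cV[R]_q :=
  [set z | (const_mx 1 : 'rV[R]_q) *m z = 1%:M /\ lev 0 z].

(* The representation [ineq_rhs >= ineq_mx x, eq_rhs = eq_mx x]. *)
Record hrep (d m n : nat) := HRep {
  ineq_rhs : 'cV[R]_m;
  ineq_mx : 'M[R]_(m, d);
  eq_rhs : 'cV[R]_n;
  eq_mx : 'M[R]_(n, d) }.

Definition hrep_eqset (d m n : nat) (r : hrep d m n) : set 'cV[R]_d :=
  [set x | eq_rhs r = eq_mx r *m x].

Definition hrep_set (d m n : nat) (r : hrep d m n) : set 'cV[R]_d :=
  polyhedron (ineq_mx r) (ineq_rhs r) `&` hrep_eqset r.

Definition hrep_standing (d m n : nat) (r : hrep d m n) : Prop :=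
  [/\ (0 < d - n)%N, has_dim (hrep_eqset r) (d - n)
    & has_dim (hrep_set r) (d - n)].

Definition lifted_polyhedron (d n q : nat) (B : 'M[R]_(q, d))
    (B' : 'M[R]_(q, n)) (b : 'cV[R]_q) : set ('cV[R]_d * 'cV[R]_n) :=
  [set w | lev (B *m w.1 + B' *m w.2) b].

Definition proj (d n : nat) (Q : set ('cV[R]_d * 'cV[R]_n)) : set 'cV[R]_d :=
  [set x | exists y, Q (x, y)].

Definition dual_polytope (n q : nat) (B' : 'M[R]_(q, n)) : set 'cV[R]_q :=
  [set z | B'^T *m z = 0] `&` @simplex q.

End Polyhedra.

(* [z^T (b - B x)], over an arbitrary ring so that it makes sense both for
   points and for vectors of polynomial variables. *)
Definition bilin (S : comNzRingType) (d q : nat) (B : 'M[S]_(q, d))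
    (b : 'cV[S]_q) (x : 'cV[S]_d) (z : 'cV[S]_q) : S :=
  (z^T *m (b - B *m x)) 0 0.

Definition bilin_optimal (R : realType) (d q : nat) (B : 'M[R]_(q, d))
    (b : 'cV[R]_q) (P : set 'cV[R]_d) (K : set 'cV[R]_q)
    (x : 'cV[R]_d) (z : 'cV[R]_q) : Prop :=
  [/\ P x, K z
    & forall x' z', P x' -> K z' -> bilin B b x z <= bilin B b x' z'].

Section Hierarchy.
Variables (R : realType) (d q : nat).

(* The first [d] of the [d + q] indeterminates are [x], the others are [z]. *)
Local Notation poly := {mpoly R[d + q]}.

Definition xvar : 'cV[poly]_d := \col_i 'X_(lshift q i).
Definition zvar : 'cV[poly]_q := \col_j 'X_(rshift d j).

Definition cst_mx (m n : nat) (A : 'M[R]_(m, n)) : 'M[poly]_(m, n) :=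
  map_mx (@mpolyC (d + q) R) A.

Definition ineq_poly (k m n : nat) (r : hrep R k m n) (v : 'cV[poly]_k) :
    'cV[poly]_m :=
  cst_mx (ineq_rhs r) - cst_mx (ineq_mx r) *m v.

Definition eq_poly (k m n : nat) (r : hrep R k m n) (v : 'cV[poly]_k) :
    'cV[poly]_n :=
  cst_mx (eq_rhs r) - cst_mx (eq_mx r) *m v.

(* [msize] is one more than the total degree, and [0] on the zero
   polynomial. *)
Definition deg_le (k : nat) (p : poly) : Prop := (msize p <= k.+1)%N.

Definition sos (k : nat) (p : poly) : Prop :=
  deg_le k p /\ exists s : seq poly, p = \sum_(g <- s) g ^+ 2.

Definition qmodule (m1 n1 m2 n2 : nat) (r1 : hrep R d m1 n1)
    (r2 : hrep R q m2 n2) (t : nat) : set poly :=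
  [set p | exists (s0 : poly) (s1 : 'I_m1 -> poly) (s2 : 'I_m2 -> poly),
     [/\ sos (2 * t) s0,
         forall j, sos (2 * t - 2) (s1 j),
         forall j, sos (2 * t - 2) (s2 j)
       & p = s0 + \sum_j s1 j * ineq_poly r1 xvar j 0
                + \sum_j s2 j * ineq_poly r2 zvar j 0]].

Definition trunc_ideal (m1 n1 m2 n2 : nat) (r1 : hrep R d m1 n1)
    (r2 : hrep R q m2 n2) (t : nat) : set poly :=
  [set p | exists (t1 : 'I_n1 -> poly) (t2 : 'I_n2 -> poly),
     [/\ forall j, deg_le (2 * t - 1) (t1 j),
         forall j, deg_le (2 * t - 1) (t2 j)
       & p = \sum_j t1 j * eq_poly r1 xvar j 0
             + \sum_j t2 j * eq_poly r2 zvar j 0]].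

Definition sos_value (m1 n1 m2 n2 : nat) (r1 : hrep R d m1 n1)
    (r2 : hrep R q m2 n2) (f : poly) (t : nat) : \bar R :=
  ereal_inf [set mu%:E | mu in
    [set mu : R | exists g h : poly,
       [/\ qmodule r1 r2 t g, trunc_ideal r1 r2 t h
         & mu%:MP - f = g + h]]].

Definition bilin_poly (B : 'M[R]_(q, d)) (b : 'cV[R]_q) : poly :=
  - bilin (cst_mx B) (cst_mx b) xvar zvar.

End Hierarchy.

(* Main.v *)
(* Write p(x,z) = z^T (b - B x). By Farkas' lemma P is contained in the
   projection of Q iff p >= 0 on P x K, and a nonpositive value of the hierarchy
   forces p >= 0 there. Conversely, let p >= 0 on P x K; it suffices that p lies
   in the (untruncated) quadratic module M of P x K.

   The zeros X_1, ..., X_s of p are pairs of vertices, hence finitely many.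
   Let e_i be a polynomial vanishing at all X_l except X_i, w one vanishing
   exactly at all of them (both univariate in a linear form separating the X_l),
   g_i the sum of the constraints active at X_i, and
     u = sum_i e_i^2 (g_i + |X - X_i|^2) + w^2.
   The polynomials b with N u +- b in M for some N form an ideal J containing p.
   If p is not in M, Zorn's lemma yields phi : J -> R, nonnegative on M, with
   phi(u) = 1, phi(p) <= 0 and phi(ab) = phi(au) phi(b) (a pure state in the
   sense of Burgdorf, Scheiderer and Schweighofer). Then a |-> phi(au) is the
   evaluation at a point, which has to be one of the X_i, and
   a |-> phi(e_i^2 (a - a(X_i))) is a point derivation at X_i, i.e. a direction
   (xi, zeta) feasible for P x K along which the derivative of p is <= 0. As p is
   affine in x and in z separately, p vanishes on a segment from X_i in direction
   (xi, 0) and on one in direction (0, zeta); since all zeros are vertices,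
   xi = zeta = 0. But then phi(u) = 0, a contradiction. *)
Require Import Defs.
From mathcomp Require Import all_boot all_order all_algebra.
From mathcomp Require Import mpoly zify ring lra.
From mathcomp Require Import boolp classical_sets reals constructive_ereal ereal.

Set Implicit Arguments.
Unset Strict Implicit.
Unset Printing Implicit Defensive.

Import Order.TTheory GRing.Theory Num.Theory.

Local Open Scope classical_set_scope.
Local Open Scope ring_scope.

(** * Quadratic modules and the elements bounded by an order unit *)

Section QuadraticModules.
Variables (R : realType) (A : comNzRingType) (c : {rmorphism R -> A}).

(** Membership of 1 is left to [quadratic_module]: the modules enlarged by Zorn's lemma below live
    inside the ideal of elements dominated by [u], which may be proper and then misses 1. *)
Definition square_module (N : A -> Prop) : Prop :=
  (forall a b, N a -> N b -> N (a + b)) /\ (forall a b, N b -> N (a ^+ 2 * b)).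

Definition quadratic_module (M : A -> Prop) : Prop := M 1 /\ square_module M.

(** In the ordering defined by [M] this is boundedness by multiples of an order unit: [u = 1] gives
    the archimedean property, and the u of the overview gives its ideal J. *)
Definition dominated (M : A -> Prop) (u b : A) : Prop :=
  exists N : R, M (c N * u - b) /\ M (c N * u + b).

Definition sum_of_squares (s : A) : Prop :=
  exists l : seq A, s = \sum_(g <- l) g ^+ 2.

Lemma square_moduleZ N r b : square_module N -> 0 <= r -> N b -> N (c r * b).
Proof.
move=> [_ NS] r0 Nb; rewrite -(sqr_sqrtr r0) rmorphXn; exact: NS.
Qed.

Lemma square_module0 N b : square_module N -> N b -> N 0.
Proof. by move=> NM Nb; have := NM.2 0 b Nb; rewrite expr0n mul0r. Qed.

Lemma sum_of_squares0 : sum_of_squares 0.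
Proof. by exists [::]; rewrite big_nil. Qed.

Lemma sum_of_squaresX a : sum_of_squares (a ^+ 2).
Proof. by exists [:: a]; rewrite big_seq1. Qed.

Lemma sum_of_squaresD s t :
  sum_of_squares s -> sum_of_squares t -> sum_of_squares (s + t).
Proof. by move=> [l ->] [k ->]; exists (l ++ k); rewrite big_cat. Qed.

Lemma sum_of_squaresM a s : sum_of_squares s -> sum_of_squares (a ^+ 2 * s).
Proof.
move=> [l ->]; exists [seq a * g | g <- l]; rewrite big_map mulr_sumr.
by apply: eq_bigr => g _; rewrite exprMn.
Qed.

Lemma square_module_sos N s b :
  square_module N -> N b -> sum_of_squares s -> N (s * b).
Proof.
move=> NM Nb [l ->]; elim: l => [|g l IH].
  by rewrite big_nil mul0r; apply: square_module0 NM Nb.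
by rewrite big_cons mulrDl; apply: NM.1 => //; apply: NM.2.
Qed.

Lemma quadratic_module_sos M s : quadratic_module M -> sum_of_squares s -> M s.
Proof. by move=> [M1 MM] sS; rewrite -[s]mulr1; apply: square_module_sos. Qed.

Lemma quadratic_module_c M r : quadratic_module M -> 0 <= r -> M (c r).
Proof. by move=> [M1 MM] r0; rewrite -[c r]mulr1; apply: square_moduleZ. Qed.

Section Dominated.
Variables (M : A -> Prop) (u : A).
Hypotheses (MM : square_module M) (Mu : M u).

Lemma dominatedP b : dominated M u b ->
  exists K : R, forall N, K <= N -> M (c N * u - b) /\ M (c N * u + b).
Proof.
move=> [K [K1 K2]]; exists K => N KN.
have Mn : M (c (N - K) * u) by apply: square_moduleZ => //; rewrite subr_ge0.
split; rewrite (_ : c N * u = c (N - K) * u + c K * u); first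
  [by rewrite -addrA; apply: MM.1 | by rewrite rmorphB; ring].
Qed.

Lemma dominatedN b : dominated M u b -> dominated M u (- b).
Proof. by move=> [K [K1 K2]]; exists K; rewrite opprK. Qed.

Lemma dominatedD a b :
  dominated M u a -> dominated M u b -> dominated M u (a + b).
Proof.
move=> [K [K1 K2]] [L [L1 L2]]; exists (K + L); rewrite rmorphD; split.
  by rewrite (_ : _ - _ = (c K * u - a) + (c L * u - b));
    [apply: MM.1 | ring].
by rewrite (_ : _ + _ = (c K * u + a) + (c L * u + b)); [apply: MM.1 | ring].
Qed.

Lemma dominated_le a b : dominated M u b -> M a -> M (b - a) -> dominated M u a.
Proof.
move=> /dominatedP[K HK] Ma Mba; exists (Num.max K 0).
have [H1 H2] : M (c (Num.max K 0) * u - b) /\ M (c (Num.max K 0) * u + b).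
  by apply: HK; rewrite le_max lexx.
split; first by rewrite (_ : _ - _ = (c (Num.max K 0) * u - b) + (b - a));
   [apply: MM.1 | ring].
apply: MM.1 => //; apply: square_moduleZ => //; by rewrite le_max lexx orbT.
Qed.

Lemma dominated_unit : dominated M u u.
Proof.
exists 1; rewrite rmorph1 mul1r subrr; split; last exact: MM.1.
exact: square_module0 MM Mu.
Qed.

Lemma dominated0 : dominated M u 0.
Proof.
by exists 0; rewrite rmorph0 mul0r subrr addr0; split; apply: square_module0 MM Mu.
Qed.

Lemma dominated_sum I (s : seq I) (F : I -> A) :
  (forall i, dominated M u (F i)) -> dominated M u (\sum_(i <- s) F i).
Proof.
move=> FJ; elim: s => [|i s IH]; first by rewrite big_nil; exact: dominated0.
by rewrite big_cons; apply: dominatedD.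
Qed.

Lemma dominated_mul_square a b : dominated M u (a ^+ 2 * u) ->
  dominated M u b -> dominated M u (a ^+ 2 * b).
Proof.
move=> /dominatedP[L HL] /dominatedP[K HK].
have [K1 K2] := HK (Num.max K 1) (ltac:(by rewrite le_max lexx)).
have m0 : 0 <= Num.max K 1 by rewrite le_max ler01 orbT.
move: K1 K2 m0; set k := Num.max K 1 => K1 K2 m0.
have [L1 L2] := HL _ (lexx L).
have := square_moduleZ MM m0 L1; have := MM.2 a _ K1; have := MM.2 a _ K2.
move=> H1 H2 H3; exists (k * L); rewrite rmorphM; split.
  by rewrite (_ : _ - _ = a ^+ 2 * (c k * u - b) + c k * (c L * u - a ^+ 2 * u));
    [apply: MM.1 | ring].
by rewrite (_ : _ + _ = a ^+ 2 * (c k * u + b) + c k * (c L * u - a ^+ 2 * u));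
    [apply: MM.1 | ring].
Qed.

Lemma dominatedZ r b : dominated M u b -> dominated M u (c r * b).
Proof.
wlog r0 : r b / 0 <= r => [hw|].
  have [r0|r0] := leP 0 r; first exact: hw.
  move=> bJ; have := hw (- r) (- b); rewrite rmorphN mulrNN oppr_ge0.
  by apply; [apply: ltW | apply: dominatedN].
move=> [K [K1 K2]]; exists (r * K); rewrite rmorphM -mulrA -mulrBr -mulrDr.
by split; apply: square_moduleZ.
Qed.

(* [4 a b = (a + 1)^2 b - (a - 1)^2 b], and [(a + 1)^2 <= 2 a^2 + 2]. *)
Lemma dominatedM a b : dominated M u (a ^+ 2 * u) ->
  dominated M u b -> dominated M u (a * b).
Proof.
move=> aJ bJ.
have h2 : c 2^-1 * 2 = 1.
  by rewrite -(rmorph_nat c 2) -rmorphM mulVf ?pnatr_eq0 // rmorph1.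
have sqJ e : e ^+ 2 = 1 -> dominated M u ((a + e) ^+ 2 * u).
  move=> e1; apply: (@dominated_le _ (c 2 * (a ^+ 2 * u) + c 2 * u)).
  - by apply: dominatedD; apply: dominatedZ => //; exact: dominated_unit.
  - exact: MM.2.
  - rewrite (_ : _ - _ = (a - e) ^+ 2 * u); first exact: MM.2.
    rewrite (_ : c 2 * u = c 2 * e ^+ 2 * u); last by rewrite e1 mulr1.
    rewrite (rmorph_nat c 2); ring.
have -> : a * b = c 2^-1 * (c 2^-1 * ((a + 1) ^+ 2 * b - (a + (-1)) ^+ 2 * b)).
  rewrite -[LHS]mul1r -[1]mulr1 -{1 2}h2; ring.
apply: dominatedZ; apply: dominatedZ; apply: dominatedD; last apply: dominatedN;
  apply: dominated_mul_square => //; apply: sqJ; by rewrite ?sqrrN expr1n.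
Qed.

End Dominated.

(** * Multiplicative states from maximal modules *)

Section States.
Variables (M : A -> Prop) (u p : A).
Hypotheses (MM : square_module M) (Mu : M u).
Hypothesis ideal : forall a b, dominated M u b -> dominated M u (a * b).
Hypothesis pJ : dominated M u p.

(** A descent with a fixed large k: if p + r u is in [M] for some r >= 0, so is p + (r - 1/k) u. It
    starts because [p] is dominated by [u] and stops once r <= 0. The step rests on k^2 (p + r u) -
    k u = (k - s)^2 (p + r u) + 2 k m + (k u - s^2 p) + r (2 k - s) s u. *)
Lemma mem_of_sos_multiple s m : sum_of_squares s -> M m -> s * p = u + m -> M p.
Proof.
move=> sS Mm sp.
have uJ := dominated_unit MM Mu.
have [K1 HK1] := dominatedP MM Mu (ideal (s ^+ 2) pJ).
have [K2 HK2] := dominatedP MM Mu (ideal s uJ).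
pose k := Num.max 1 (Num.max K1 K2).
have k1 : 1 <= k by rewrite le_max lexx.
have k0 : 0 < k by apply: lt_le_trans k1.
have [HA _] := HK1 k (ltac:(by rewrite !le_max lexx !orbT)).
have [HB _] : M (c (2 * k) * u - s * u) /\ M (c (2 * k) * u + s * u).
  apply: HK2; apply: (@le_trans _ _ k); first by rewrite !le_max lexx !orbT.
  by rewrite mulr_natl mulr2n lerDl ltW.
have inv x y : 0 < y -> M (c y * x) -> M x.
  move=> y0 Mx; rewrite -[x]mul1r -(rmorph1 c) -(mulVf (lt0r_neq0 y0)) rmorphM -mulrA.
  by apply: square_moduleZ => //; rewrite invr_ge0 ltW.
(* [M] is not closed under products, so this comes from 2 k (2 k - s) s = s^2 (2 k - s) + (2 k -
   s)^2 s. *)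
have HC : M ((c (2 * k) - s) * s * u).
  apply: (inv _ (2 * k)); first by rewrite mulr_gt0.
  rewrite (_ : _ * _ = s ^+ 2 * (c (2 * k) * u - s * u) + (c (2 * k) - s) ^+ 2 * (s * u)).
    by apply: MM.1; apply: MM.2 => //; apply: square_module_sos.
  ring.
have step r : 0 <= r -> M (p + c r * u) -> M (p + c (r - k^-1) * u).
  move=> r0 Mr; apply: (inv _ (k ^+ 2)); first by rewrite exprn_gt0.
  have kk : c k * c k^-1 = 1 by rewrite -rmorphM mulfV ?rmorph1 // lt0r_neq0.
  have -> : c (k ^+ 2) * (p + c (r - k^-1) * u) =
     c k ^+ 2 * (p + c r * u) - c k * u.
    rewrite rmorphXn rmorphB.
    transitivity (c k ^+ 2 * (p + c r * u) - c k * (c k * c k^-1) * u); first by ring.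
    by rewrite kk mulr1.
  have -> : c k ^+ 2 * (p + c r * u) - c k * u =
    (c k - s) ^+ 2 * (p + c r * u) + (c (2 * k) * m + (c k * u - s ^+ 2 * p)
      + c r * ((c (2 * k) - s) * s * u)).
    have -> : m = s * p - u by rewrite sp; ring.
    by rewrite rmorphM (rmorph_nat c 2); ring.
  apply: MM.1; first exact: MM.2.
  apply: MM.1; last exact: square_moduleZ.
  by apply: MM.1 => //; apply: square_moduleZ => //; rewrite mulr_ge0 // ltW.
have base r : r <= 0 -> M (p + c r * u) -> M p.
  move=> r0 Mr; rewrite (_ : p = (p + c r * u) + c (- r) * u); last first.
    by rewrite rmorphN; ring.
  by apply: MM.1 => //; apply: square_moduleZ => //; rewrite oppr_ge0.
have descent n : forall r, r <= n%:R / k -> M (p + c r * u) -> M p.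
  elim: n => [|n IH] r rn Mr; first by apply: base Mr; rewrite mul0r in rn.
  have [r0|r0] := leP r 0; first exact: base Mr.
  apply: (IH (r - k^-1)); last by apply: step => //; apply: ltW.
  by rewrite lerBlDr -[X in _ + X]mul1r -mulrDl natr1.
have [K [_ HK]] := pJ.
apply: (descent (Num.bound `|K * k|) K); last by rewrite addrC.
rewrite ler_pdivlMr //; apply/ltW; apply: le_lt_trans (ler_norm _) _.
exact/archi_boundP/normr_ge0.
Qed.

(** The square-closed module generated by [- p] and the part of [M] inside the ideal; a state
    nonnegative on it is at most 0 at [p]. *)
Definition base_module : set A := [set b | exists s m,
  [/\ sum_of_squares s, M m, dominated M u m & b = m - s * p]].

Definition admissible (N : set A) : Prop :=
  [/\ base_module `<=` N, N `<=` dominated M u, square_module N & ~ N (- u)].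

(** From [- u = m - s * p] one gets [s * p = u + m], and [mem_of_sos_multiple] would put [p] in
    [M]. *)
Lemma admissible_base : ~ M p -> admissible base_module.
Proof.
move=> nMp; split => //.
- move=> b [s [m [_ _ mJ ->]]]; apply: dominatedD => //.
  by apply: dominatedN; apply: ideal.
- split=> [a b [s [m [Hs Hm Jm ->]]] [t [l [Ht Hl Jl ->]]]|a b [s [m [Hs Hm Jm ->]]]].
    exists (s + t), (m + l); split; [exact: sum_of_squaresD|exact: MM.1|exact: dominatedD|].
    by ring.
  exists (a ^+ 2 * s), (a ^+ 2 * m).
  split; [exact: sum_of_squaresM|exact: MM.2|exact: ideal|by ring].
- move=> [s [m [Hs Hm _ E]]]; apply: nMp; apply: (mem_of_sos_multiple Hs Hm).
  by rewrite -[u]opprK E; ring.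
Qed.

Lemma exists_maximal_admissible : ~ M p ->
  exists N, admissible N /\ forall N', admissible N' -> N `<=` N' -> N' `<=` N.
Proof.
move=> nMp; have [B0 BJ BM Bu] := admissible_base nMp.
(* Zorn's lemma runs over the sets [X] whose union with the base module is admissible, so that the
   empty chain is covered as well. *)
have [F FP Ftot|X [PX Xmax]] := @Zorn_bigcup A (fun X => admissible (base_module `|` X)).
  have sub X : F X -> base_module `|` X `<=` base_module `|` \bigcup_(X in F) X.
    by move=> FX b [|bX]; [left|right; exists X].
  split; first by move=> b; left.
  - by move=> b [/BJ //|[X FX bX]]; have [_ H _ _] := FP _ FX; apply: H; right.
  - split=> [a b|a b].
      move=> [aB|[X FX aX]] [bB|[Y FY bY]]; first by left; apply: BM.1.
      + by apply: (sub _ FY); have [_ _ H _] := FP _ FY; apply: H.1; [left|right].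
      + by apply: (sub _ FX); have [_ _ H _] := FP _ FX; apply: H.1; [right|left].
      + have [XY|YX] := Ftot _ _ FX FY.
          apply: (sub _ FY); have [_ _ H _] := FP _ FY; apply: H.1; right => //.
          exact: XY.
        apply: (sub _ FX); have [_ _ H _] := FP _ FX; apply: H.1; right => //.
        exact: YX.
    move=> [bB|[X FX bX]]; first by left; apply: BM.2.
    by apply: (sub _ FX); have [_ _ H _] := FP _ FX; apply: H.2; right.
  - by move=> [//|[X FX uX]]; have [_ _ _] := FP _ FX; apply; right.
exists (base_module `|` X); split=> // N' AN' NN' b bN'.
apply: contrapT => nb; apply: (Xmax N').
  split; first by move=> e eX; apply: NN'; right.
  by move=> N'X; apply: nb; right; apply: N'X.
by have [/setUidPr -> _ _ _] := AN'.
Qed.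

Section MaximalModule.
Variable N : set A.
Hypothesis AN : admissible N.
Hypothesis Nmax : forall N', admissible N' -> N `<=` N' -> N' `<=` N.

Let NM : square_module N. Proof. by case: AN. Qed.
Let NJ : N `<=` dominated M u. Proof. by case: AN. Qed.
Let Nu : ~ N (- u). Proof. by case: AN. Qed.

Lemma admissible_mem b : M b -> dominated M u b -> N b.
Proof.
move=> Mb bJ; case: AN => [H _ _ _]; apply: H; exists 0, b.
by split => //; [exact: sum_of_squares0 | rewrite mul0r subr0].
Qed.

Lemma admissible_unit : N u.
Proof. by apply: admissible_mem => //; exact: dominated_unit. Qed.

Lemma admissible_opp : N (- p).
Proof.
case: AN => [H _ _ _]; apply: H; exists (1 ^+ 2), 0; split.
- exact: sum_of_squaresX.
- exact: square_module0 MM Mu.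
- exact: dominated0.
- by rewrite expr1n mul1r sub0r.
Qed.

(** By maximality, adjoining [b] destroys admissibility, and the only condition that can fail is the
    exclusion of [- u]. *)
Lemma maximal_extend b : dominated M u b -> ~ N b ->
  exists n s, [/\ N n, sum_of_squares s & - u = n + s * b].
Proof.
move=> bJ nNb; apply: contrapT => H; apply: nNb.
pose N' : set A := [set d | exists n s, [/\ N n, sum_of_squares s & d = n + s * b]].
have N0 : N 0 by apply: square_module0 NM admissible_unit.
have NN' : N `<=` N'.
  move=> d Nd; exists d, 0; split => //; first exact: sum_of_squares0.
  by rewrite mul0r addr0.
suff AN' : admissible N'.
  apply: (Nmax AN' NN'); exists 0, (1 ^+ 2); split=> //; first exact: sum_of_squaresX.
  by rewrite expr1n mul1r add0r.
split.
- by case: AN => [B _ _ _]; apply: subset_trans NN'.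
- by move=> d [n [s [Nn _ ->]]]; apply: dominatedD; [|exact: NJ|exact: ideal].
- split=> [d e [n [s [Nn Ss ->]]] [k [t [Nk St ->]]]|a d [n [s [Nn Ss ->]]]].
    exists (n + k), (s + t); split; [exact: NM.1|exact: sum_of_squaresD|ring].
  exists (a ^+ 2 * n), (a ^+ 2 * s); split; [exact: NM.2|exact: sum_of_squaresM|ring].
- by move=> [n [s [Nn Ss E]]]; apply: H; exists n, s.
Qed.

(* If [-u = n1 + s1 b = n2 - s2 b] with [n_i] in [N] and [s_i] sums of squares,
   then [-(s1 + s2) u] is in [N], hence so are [-s1 u] and, as [b <= K u],
   also [s1 b] and [-u], a contradiction. *)
Lemma maximal_total b : dominated M u b -> N b \/ N (- b).
Proof.
move=> bJ; apply: contrapT => /not_orP[nb nb'].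
have [n1 [s1 [N1 S1 E1]]] := maximal_extend bJ nb.
have [n2 [s2 [N2 S2 E2]]] := maximal_extend (dominatedN bJ) nb'.
have Nsu : N (- (s1 * u)).
  rewrite (_ : - _ = s2 * n1 + s1 * n2 + s2 * u).
    apply: NM.1; last exact: square_module_sos admissible_unit S2.
    by apply: NM.1; apply: square_module_sos.
  transitivity (s2 * - u + s1 * - u + s2 * u); first by ring.
  by rewrite {1}E1 E2; ring.
have [K HK] := dominatedP MM Mu bJ.
have [] := HK (Num.max K 0) (ltac:(by rewrite le_max lexx)).
set k := Num.max K 0 => _ Hk.
have k0 : 0 <= k by rewrite le_max lexx orbT.
have kJ : dominated M u (c k * u + b).
  by apply: dominatedD => //; apply: dominatedZ => //; exact: dominated_unit.
apply: Nu; rewrite E1; apply: NM.1 => //.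
rewrite (_ : s1 * b = s1 * (c k * u + b) + c k * (- (s1 * u))); last by ring.
apply: NM.1; last exact: square_moduleZ.
by apply: square_module_sos => //; exact: admissible_mem.
Qed.

(** The cut that [b] makes among the multiples of [u] in the total preorder given by [N]. *)
Definition state (b : A) : R := sup [set r | N (b - c r * u)].

Lemma maximal_coeff_ge0 r : N (c r * u) -> 0 <= r.
Proof.
move=> Nr; rewrite leNgt; apply/negP => r0; apply: Nu.
have ir : 0 <= - r^-1 by rewrite oppr_ge0 invr_le0 ltW.
have := square_moduleZ NM ir Nr.
by rewrite mulrA -rmorphM mulNr mulVf ?ltr0_neq0 // rmorphN rmorph1 mulN1r.
Qed.

(** [N] need not be closed, hence the slack [e]. The lower bound is the approximation property of
    the supremum; the upper one follows from [maximal_total], since otherwise [state b + e] would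
    belong to the set. *)
Lemma stateP b : dominated M u b -> forall e, 0 < e ->
  N (b - c (state b - e) * u) /\ N (c (state b + e) * u - b).
Proof.
move=> bJ e e0; have uJ := dominated_unit MM Mu.
have linJ r : dominated M u (b - c r * u).
  by apply: dominatedD => //; apply: dominatedN; apply: dominatedZ.
have [K [K1 K2]] := bJ.
have KN x : M x -> dominated M u x -> N x by apply: admissible_mem.
have supS : has_sup [set r | N (b - c r * u)].
  split; first exists (- K).
    have := linJ (- K); rewrite /= rmorphN mulNr opprK addrC; exact: KN.
  exists K => r /= Nr; rewrite -subr_ge0; apply: maximal_coeff_ge0.
  rewrite (_ : _ * u = (c K * u - b) + (b - c r * u)); last by rewrite rmorphB; ring.
  apply: NM.1 => //; apply: KN => //; rewrite -opprB.
  by apply: dominatedN; exact: linJ.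
split.
  have [r /= Nr er] := sup_adherent e0 supS.
  rewrite (_ : _ - _ = (b - c r * u) + c (r - (state b - e)) * u).
    apply: NM.1 => //; apply: square_moduleZ => //; last exact: admissible_unit.
    by rewrite subr_ge0 ltW.
  by rewrite !rmorphB; ring.
have [Nb|] := maximal_total (linJ (state b + e)); last by rewrite opprB.
have : state b + e <= state b by apply: (sup_upper_bound supS).
by rewrite gerDl leNgt e0.
Qed.

Lemma state_ge b t : dominated M u b ->
  (forall e, 0 < e -> N (b - c (t - e) * u)) -> t <= state b.
Proof.
move=> bJ Nb; apply/ler_addgt0Pr => e e0.
have e2 : 0 < e / 2 by rewrite divr_gt0.
have [_ H] := stateP bJ e2; rewrite -subr_ge0; apply: maximal_coeff_ge0.
rewrite (_ : _ * u = (b - c (t - e / 2) * u) + (c (state b + e / 2) * u - b)).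
  by apply: NM.1 => //; exact: Nb.
rewrite {1}[e]splitr !(rmorphB, rmorphD); ring.
Qed.

Lemma state_le b t : dominated M u b ->
  (forall e, 0 < e -> N (c (t + e) * u - b)) -> state b <= t.
Proof.
move=> bJ Nb; apply/ler_addgt0Pr => e e0.
have e2 : 0 < e / 2 by rewrite divr_gt0.
have [H _] := stateP bJ e2; rewrite -subr_ge0; apply: maximal_coeff_ge0.
rewrite (_ : _ * u = (b - c (state b - e / 2) * u) + (c (t + e / 2) * u - b)).
  by apply: NM.1 => //; exact: Nb.
rewrite {1}[e]splitr !(rmorphB, rmorphD); ring.
Qed.

Lemma state_mem_ge0 b : N b -> 0 <= state b.
Proof.
move=> Nb; apply: state_ge; first exact: NJ.
move=> e e0; rewrite sub0r rmorphN mulNr opprK; apply: NM.1 => //.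
by apply: square_moduleZ admissible_unit; rewrite ?ltW.
Qed.

Lemma stateD a b : dominated M u a -> dominated M u b ->
  state (a + b) = state a + state b.
Proof.
move=> aJ bJ; apply/eqP; rewrite eq_le; apply/andP; split.
  apply: state_le; first exact: dominatedD.
  move=> e e0; have e2 : 0 < e / 2 by rewrite divr_gt0.
  have [_ Ha] := stateP aJ e2; have [_ Hb] := stateP bJ e2.
  have := NM.1 _ _ Ha Hb; rewrite [e in X in _ -> X]splitr !rmorphD; congr N; ring.
apply: state_ge; first exact: dominatedD.
move=> e e0; have e2 : 0 < e / 2 by rewrite divr_gt0.
have [Ha _] := stateP aJ e2; have [Hb _] := stateP bJ e2.
have := NM.1 _ _ Ha Hb; rewrite [e in X in _ -> X]splitr !(rmorphB, rmorphD).
congr N; ring.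
Qed.

Lemma state_scale_unit r : state (c r * u) = r.
Proof.
have uJ := dominated_unit MM Mu.
have eN e : 0 < e -> N (c e * u).
  by move=> e0; apply: square_moduleZ admissible_unit; rewrite ?ltW.
apply/eqP; rewrite eq_le; apply/andP; split.
  apply: state_le => [|e /eN]; first exact: dominatedZ.
  by congr N; rewrite rmorphD; ring.
apply: state_ge => [|e /eN]; first exact: dominatedZ.
by congr N; rewrite rmorphB; ring.
Qed.

Lemma stateZ r b : dominated M u b -> state (c r * b) = r * state b.
Proof.
have pos t x : 0 < t -> dominated M u x -> state (c t * x) = t * state x.
  move=> t0 xJ; have et e : t * (e / t) = e by rewrite mulrC divfK ?gt_eqF.
  apply/eqP; rewrite eq_le; apply/andP; split.
    apply: state_le => [|e e0]; first exact: dominatedZ.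
    have [_ H] := stateP xJ (divr_gt0 e0 t0); have := square_moduleZ NM (ltW t0) H.
    by rewrite -{2}(et e) -mulrDr rmorphM; congr N; ring.
  apply: state_ge => [|e e0]; first exact: dominatedZ.
  have [H _] := stateP xJ (divr_gt0 e0 t0); have := square_moduleZ NM (ltW t0) H.
  by rewrite -{2}(et e) -mulrBr rmorphM; congr N; ring.
have state0 : state 0 = 0 by have := state_scale_unit 0; rewrite rmorph0 mul0r.
move=> bJ; have [r0|r0|<-] := ltgtP 0 r; first exact: pos.
  have := stateD (dominatedZ MM r bJ) (dominatedZ MM (- r) bJ).
  rewrite -mulrDl -rmorphD subrr rmorph0 mul0r state0 (pos (- r)) ?oppr_gt0 // mulNr.
  by move=> /esym/eqP; rewrite subr_eq0 => /eqP.
by rewrite mul0r rmorph0 mul0r.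
Qed.

Lemma state_mono a b : dominated M u a -> N (b - a) -> state a <= state b.
Proof.
move=> aJ Nab; rewrite -[b](subrKC a) stateD ?lerDl //; first exact: state_mem_ge0.
exact: NJ.
Qed.

(* [N] is closed under multiplication by squares, so multiplying
   [(state b - e) u <= b <= (state b + e) u] by [a ^+ 2] is legitimate. *)
Lemma state_square a b : dominated M u b ->
  state (a ^+ 2 * b) = state (a ^+ 2 * u) * state b.
Proof.
move=> bJ; have uJ := dominated_unit MM Mu.
have aJ := ideal (a ^+ 2) uJ; have abJ := ideal (a ^+ 2) bJ.
have al0 : 0 <= state (a ^+ 2 * u).
  by apply: state_mem_ge0; apply: NM.2; exact: admissible_unit.
set al := state (a ^+ 2 * u) in al0 *.
have key e : 0 < e -> `|state (a ^+ 2 * b) - al * state b| <= e * al.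
  move=> e0; have [Ha Hb] := stateP bJ e0.
  have := state_mono (dominatedZ MM (state b - e) aJ) (b := a ^+ 2 * b).
  have := state_mono abJ (b := c (state b + e) * (a ^+ 2 * u)).
  rewrite !stateZ // -/al ler_distl => H1 H2.
  have {}H1 : state (a ^+ 2 * b) <= (state b + e) * al.
    by apply: H1; move: (NM.2 a _ Hb); congr N; ring.
  have {}H2 : (state b - e) * al <= state (a ^+ 2 * b).
    by apply: H2; move: (NM.2 a _ Ha); congr N; ring.
  by move: H1 H2; rewrite mulrDl mulrBl [al * _]mulrC => -> ->.
apply/eqP; rewrite -subr_eq0 -normr_le0; apply/ler_addgt0Pr => e e0.
rewrite add0r; apply: le_trans (key (e / (1 + al)) _) _.
  by rewrite divr_gt0 // ltr_wpDr.
by rewrite mulrAC ler_pdivrMr ?ltr_wpDr // mulrDr mulr1 lerDr ltW.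
Qed.

(** Polarization, 4 a x = (a + 1)^2 x - (a - 1)^2 x, for x = b and x = u reduces this to
    [state_square]. *)
Lemma stateM a b : dominated M u b -> state (a * b) = state (a * u) * state b.
Proof.
move=> bJ; have uJ := dominated_unit MM Mu.
have h2 : c 2^-1 * 2 = 1.
  by rewrite -(rmorph_nat c 2) -rmorphM mulVf ?pnatr_eq0 // rmorph1.
have polar x : dominated M u x -> state (a * x) =
    2^-1 * (2^-1 * (state ((a + 1) ^+ 2 * x) - state ((a - 1) ^+ 2 * x))).
  move=> xJ; have aJ d := ideal ((a + d) ^+ 2) xJ.
  have -> : a * x = c 2^-1 * (c 2^-1 * ((a + 1) ^+ 2 * x + c (-1) * ((a - 1) ^+ 2 * x))).
    by rewrite -[LHS]mul1r -[1]mulr1 -{1 2}h2 rmorphN rmorph1; ring.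
  rewrite !(stateZ, stateD) ?mulN1r //; repeat (apply: dominatedZ => //);
    by apply: dominatedD => //; apply: dominatedZ.
by rewrite !polar // !(state_square _ bJ); ring.
Qed.

End MaximalModule.

Lemma exists_multiplicative_state : ~ M p -> exists phi : A -> R,
  [/\ forall b, M b -> dominated M u b -> 0 <= phi b,
      phi p <= 0,
      forall a b, dominated M u a -> dominated M u b -> phi (a + b) = phi a + phi b,
      forall r, phi (c r * u) = r
    & forall a b, dominated M u b -> phi (a * b) = phi (a * u) * phi b].
Proof.
move=> /exists_maximal_admissible[N [AN Nmax]]; exists (state N); split.
- by move=> b Mb bJ; apply: state_mem_ge0 => //; apply: admissible_mem.
- rewrite -oppr_ge0.
  have -> : - state N p = state N (- p).
    by rewrite -[- p]mulN1r -[-1](rmorphN1 c) stateZ // mulN1r.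
  by apply: state_mem_ge0 => //; apply: admissible_opp.
- by move=> a b; apply: stateD.
- by move=> r; apply: state_scale_unit.
- by move=> a b; apply: stateM.
Qed.

End States.
End QuadraticModules.

(** * Farkas' lemma for linear functionals *)

Section Farkas.
Variables (R : realFieldType) (W : lmodType R).

Definition functional (g : W -> R) : Prop :=
  forall k x y, g (k *: x + y) = k * g x + g y.

Lemma functional_comb g h k : functional g -> functional h ->
  functional (fun x => g x - k * h x).
Proof. by move=> gL hL t x y; rewrite gL hL; ring. Qed.

Lemma functional0 : functional (fun=> 0).
Proof. by move=> k x y; rewrite mulr0 addr0. Qed.

Lemma functionalN g : functional g -> functional (fun x => - g x).
Proof. by move=> gL t x y; rewrite gL; ring. Qed.

Lemma functional_at0 g : functional g -> g 0 = 0.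
Proof. by move=> gL; have := gL (-1) 0 0; rewrite scaler0 addr0 mulN1r addNr. Qed.

Lemma functional_atZ g k x : functional g -> g (k *: x) = k * g x.
Proof. by move=> gL; rewrite -[k *: x]addr0 gL functional_at0 // addr0. Qed.

(* Bartl's induction: if the first [m] constraints do not suffice, some [x0]
   satisfies them with [g x0 > 0], so the remaining one is positive at [x0];
   project everything along [x0] onto the kernel of the remaining one. *)
Lemma farkas_ord m (a : 'I_m -> W -> R) (g : W -> R) :
  (forall i, functional (a i)) -> functional g ->
  (forall x, (forall i, a i x <= 0) -> g x <= 0) ->
  exists v : 'I_m -> R, (forall i, 0 <= v i) /\ forall x, g x = \sum_i v i * a i x.
Proof.
elim: m a g => [|m IH] a g aL gL ag.
  exists (fun=> 0); split => // x; rewrite big_ord0; apply/eqP; rewrite eq_le.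
  rewrite ag; last by case.
  rewrite -oppr_le0 -mulN1r -functional_atZ // ag //; by case.
have [H|H] := pselect (forall x, (forall i, a (lift ord0 i) x <= 0) -> g x <= 0).
  have [v [v0 vE]] := IH _ _ (fun i => aL (lift ord0 i)) gL H.
  exists (fun i => if unlift ord0 i is Some j then v j else 0); split.
    by move=> i; case: unliftP.
  move=> x; rewrite big_ord_recl unlift_none mul0r add0r vE.
  by apply: eq_bigr => i _; rewrite liftK.
have [x0 [ax0 gx0]] : exists x0, (forall i, a (lift ord0 i) x0 <= 0) /\ 0 < g x0.
  apply: contrapT => nx; apply: H => x ax; rewrite leNgt; apply/negP => gx.
  by apply: nx; exists x.
have a0 : 0 < a ord0 x0.
  rewrite ltNge; apply/negP => a0; move: gx0; rewrite ltNge ag // => i.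
  by case: (unliftP ord0 i) => [j ->|->].
pose s := (a ord0 x0)^-1.
have [v [v0 vE]] := IH
  (fun i x => a (lift ord0 i) x - s * a (lift ord0 i) x0 * a ord0 x)
  (fun x => g x - s * g x0 * a ord0 x)
  (fun i => functional_comb _ (aL _) (aL _)) (functional_comb _ gL (aL _))
  (ltac:(move=> x Hx;
     have := ag (- (s * a ord0 x) *: x0 + x); rewrite gL => H1;
     rewrite (_ : _ - _ = - (s * a ord0 x) * g x0 + g x); [|by ring];
     apply: H1 => i; rewrite aL;
     case: (unliftP ord0 i) => [j ->|->];
     [ move: (Hx j); congr (_ <= _); ring
     | by rewrite mulNr mulrAC mulVf ?mul1r ?addNr // gt_eqF])).
exists (fun i => if unlift ord0 i is Some j then v j
         else s * (g x0 - \sum_j v j * a (lift ord0 j) x0)); split.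
  move=> i; case: unliftP => //= _; rewrite mulr_ge0 ?invr_ge0 ?ltW //.
  rewrite subr_gt0; apply: le_lt_trans gx0; apply: sumr_le0 => j _.
  by rewrite mulr_ge0_le0.
move=> x; rewrite big_ord_recl unlift_none -[LHS](subrK (s * g x0 * a ord0 x)) vE.
under eq_bigr => i _ do rewrite mulrBr.
rewrite sumrB [X in _ = _ + X](eq_bigr (fun i => v i * a (lift ord0 i) x)); last first.
  by move=> i _; rewrite liftK.
have -> : \sum_i v i * (s * a (lift ord0 i) x0 * a ord0 x) =
   s * a ord0 x * \sum_i v i * a (lift ord0 i) x0.
  by rewrite mulr_sumr; apply: eq_bigr => i _; ring.
ring.
Qed.

Lemma farkas (I : finType) (a : I -> W -> R) (g : W -> R) :
  (forall i, functional (a i)) -> functional g ->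
  (forall x, (forall i, a i x <= 0) -> g x <= 0) ->
  exists v : I -> R, (forall i, 0 <= v i) /\ forall x, g x = \sum_i v i * a i x.
Proof.
move=> aL gL ag.
have [v [v0 vE]] := @farkas_ord #|I| (fun i => a (enum_val i)) g
  (fun i => aL _) gL (ltac:(move=> x Hx; apply: ag => i; rewrite -[i]enum_rankK; exact: Hx)).
exists (fun i => v (enum_rank i)); split=> // x; rewrite vE.
rewrite [RHS](reindex (fun i : 'I_#|I| => enum_val i)) /=; last first.
  by exists enum_rank => i _; [exact: enum_valK|exact: enum_rankK].
by apply: eq_bigr => i _; rewrite enum_valK.
Qed.

Lemma farkas_eq (I K : finType) (a : I -> W -> R) (e : K -> W -> R) (g : W -> R) :
  (forall i, functional (a i)) -> (forall k, functional (e k)) -> functional g ->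
  (forall x, (forall i, a i x <= 0) -> (forall k, e k x = 0) -> g x <= 0) ->
  exists (v : I -> R) (w : K -> R), (forall i, 0 <= v i) /\
    forall x, g x = \sum_i v i * a i x + \sum_k w k * e k x.
Proof.
move=> aL eL gL age.
pose f (i : I + (K + K)) : W -> R := match i with
  | inl i => a i | inr (inl k) => e k | inr (inr k) => fun x => - e k x end.
have [|x Hx|v [v0 vE]] := @farkas _ f g _ gL.
- by move=> [i|[k|k]] //=; apply: functionalN.
- apply: age => [i|k]; first exact: (Hx (inl i)).
  apply/eqP; rewrite eq_le (Hx (inr (inl k))) /= -oppr_le0.
  exact: (Hx (inr (inr k))).
exists (fun i => v (inl i)), (fun k => v (inr (inl k)) - v (inr (inr k))).
split=> // x; rewrite vE !big_sumType /=; congr (_ + _).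
rewrite -big_split /=; apply: eq_bigr => k _; ring.
Qed.

End Farkas.

(** * Affine Farkas lemma, feasible directions and vertices *)

Section Polyhedra.
Variables (R : realType) (k m n : nat) (r : hrep R k m n).

Local Notation "'ia'" := (ineq_rhs r).
Local Notation "'Am'" := (ineq_mx r).
Local Notation "'ib'" := (eq_rhs r).
Local Notation "'Bm'" := (Defs.eq_mx r).

Lemma functional_mx (p : nat) (C : 'M[R]_(p, k)) j :
  functional (fun x : 'cV[R]_k => (C *m x) j 0).
Proof. by move=> t x y; rewrite mulmxDr -scalemxAr !mxE. Qed.

Lemma row_ext (u v : 'rV[R]_k) :
  (forall x : 'cV[R]_k, (u *m x) 0 0 = (v *m x) 0 0) -> u = v.
Proof.
move=> uv; apply/rowP => i; have := uv (delta_mx i 0).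
by rewrite -!colE !mxE.
Qed.

Lemma hrep_setP x : hrep_set r x <->
  (forall j, (Am *m x) j 0 <= ia j 0) /\ Bm *m x = ib.
Proof. by split=> -[]. Qed.

(** Homogenization with an extra coordinate [y.2 >= 0]. For [y.2 > 0] the point [y.1] divided by
    [y.2] lies in the polyhedron; for [y.2 = 0], [y.1] is a recession direction, along which [u]
    cannot grow because it is bounded on a nonempty set. The multiplier of [- y.2] is the slack in
    the final inequality. *)
Lemma affine_farkas (u : 'rV[R]_k) (dl : R) : hrep_set r !=set0 ->
  (forall x, hrep_set r x -> (u *m x) 0 0 <= dl) ->
  exists (v : 'rV[R]_m) (w : 'rV[R]_n), [/\ forall j, 0 <= v 0 j,
    u = v *m Am + w *m Bm & (v *m ia + w *m ib) 0 0 <= dl].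
Proof.
move=> [x0 /hrep_setP[Ax0 Bx0]] udl.
pose W := ('cV[R]_k * R^o)%type.
pose f (i : 'I_m + 'I_1) (y : W) : R :=
  if i is inl j then (Am *m y.1) j 0 - ia j 0 * y.2 else - y.2.
pose e (j : 'I_n) (y : W) : R := (Bm *m y.1) j 0 - ib j 0 * y.2.
have snd_fun : functional (fun y : W => y.2 : R) by [].
have fst_fun p (C : 'M[R]_(p, k)) j : functional (fun y : W => (C *m y.1) j 0).
  by move=> t y y'; exact: functional_mx.
have [|||y Hf He|v [w [v0 E]]] := @farkas_eq R W _ _ f e
  (fun y => (u *m y.1) 0 0 - dl * y.2).
- by move=> [j|j]; [exact: functional_comb|exact: functionalN].
- by move=> j; exact: functional_comb.
- exact: functional_comb.
- have y0 : 0 <= y.2 by have := Hf (inr 0); rewrite /= oppr_le0.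
  have Hj j : (Am *m y.1) j 0 <= y.2 * ia j 0.
    by have := Hf (inl j); rewrite /= subr_le0 mulrC.
  have Hk : Bm *m y.1 = y.2 *: ib.
    apply/colP => j; have /eqP := He j; rewrite subr_eq0 => /eqP ->.
    by rewrite mxE mulrC.
  rewrite subr_le0 mulrC.
  have [y0'|y0'|y0'] := ltgtP y.2 0; first by rewrite ltNge y0 in y0'.
    have := udl (y.2^-1 *: y.1); rewrite -scalemxAr mxE ler_pdivrMl //; apply.
    apply/hrep_setP; split=> [j|]; rewrite -scalemxAr.
      by rewrite mxE ler_pdivrMl.
    by rewrite Hk scalerA mulVf ?scale1r // gt_eqF.
  rewrite y0' mul0r leNgt; apply/negP => u0.
  (* Chosen so that [u] takes the value [dl + 1] at [t *: y.1 + x0]. *)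
  pose t := (dl - (u *m x0) 0 0 + 1) / (u *m y.1) 0 0.
  have t0 : 0 <= t.
    apply: divr_ge0; last exact: ltW.
    by rewrite addr_ge0 // subr_ge0 udl //; apply/hrep_setP.
  have := udl (t *: y.1 + x0); rewrite functional_mx divfK ?gt_eqF // => H.
  have : dl - (u *m x0) 0 0 + 1 + (u *m x0) 0 0 <= dl.
    apply: H; apply/hrep_setP; split=> [j|].
      rewrite functional_mx -[leRHS]add0r lerD // mulr_ge0_le0 //.
      by have := Hj j; rewrite y0' mul0r.
    by rewrite mulmxDr -scalemxAr Hk y0' scale0r scaler0 add0r.
  by rewrite addrAC subrK gerDl leNgt ltr01.
exists (\row_j v (inl j)), (\row_j w j); split.
- by move=> j; rewrite mxE.
- apply: row_ext => x; have := E (x, 0); rewrite /= mulr0 subr0 => ->.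
  rewrite mulmxDl -!mulmxA mxE big_sumType big_ord1 /= oppr0 mulr0 addr0.
  by congr (_ + _); rewrite [in RHS]mxE; apply: eq_bigr => j _;
    rewrite /e /= mulr0 subr0 mxE.
- have := E (0, 1); rewrite /= mulmx0 mxE mulr1 sub0r => E1.
  have {}E1 : dl = v (inr 0) + (\row_j v (inl j) *m ia) 0 0 + (\row_j w j *m ib) 0 0.
    rewrite -[dl]opprK E1 big_sumType big_ord1 /= !opprD mulrN1 opprK.
    rewrite [- _ + _]addrC -!sumrN !mxE; congr (_ + _ + _);
      by apply: eq_bigr => j _; rewrite /e /= mulmx0 !mxE sub0r mulr1 mulrN opprK.
  by rewrite mxE [leRHS]E1 -addrA lerDr.
Qed.

Definition active (v : 'cV[R]_k) (j : 'I_m) : bool := (Am *m v) j 0 == ia j 0.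

Lemma feasible_direction (v xi : 'cV[R]_k) : hrep_set r v ->
  (forall j, active v j -> (Am *m xi) j 0 <= 0) -> Bm *m xi = 0 ->
  exists e, 0 < e /\ forall t, 0 <= t -> t <= e -> hrep_set r (v + t *: xi).
Proof.
move=> /hrep_setP[Av Bv] Axi Bxi.
(* The inverse of [T] is a safe step length for every inactive constraint. An active one has slack 0
   and contributes 0, as division by zero gives 0. *)
pose T := 1 + \sum_j `|(Am *m xi) j 0| / (ia j 0 - (Am *m v) j 0).
have T1 : 1 <= T.
  by rewrite lerDl sumr_ge0 // => j _; rewrite divr_ge0 // subr_ge0.
have T0 : 0 < T by apply: lt_le_trans T1.
exists T^-1; split; first by rewrite invr_gt0.
move=> t t0 tT; apply/hrep_setP; split=> [j|]; last first.
  by rewrite mulmxDr -scalemxAr Bxi scaler0 addr0.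
rewrite addrC functional_mx addrC.
have [/[dup] aj /eqP aE|naj] := boolP (active v j).
  by rewrite -aE -[leRHS]addr0 lerD // mulr_ge0_le0 // Axi.
have sj : 0 < ia j 0 - (Am *m v) j 0 by rewrite subr_gt0 lt_neqAle naj Av.
rewrite -lerBrDl; apply: le_trans (ler_norm _) _; rewrite normrM ger0_norm //.
rewrite -[leRHS]mul1r -ler_pdivrMr // -mulrA; apply: (@le_trans _ _ (T^-1 * T)); last first.
  by rewrite mulVf // gt_eqF.
apply: ler_pM => //; first by rewrite divr_ge0 // ltW.
rewrite /T (bigD1 j) //= addrCA lerDl addr_ge0 // sumr_ge0 // => i _.
by rewrite divr_ge0 // subr_ge0.
Qed.

Lemma vertex_not_midpoint (S : set 'cV[R]_k) v xi :
  vertex S v -> S (v + xi) -> S (v - xi) -> xi = 0.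
Proof.
move=> [_ [u Hu]] Sp Sm; apply: contrapT => /eqP xi0.
have np : v + xi <> v by move=> /eqP; rewrite -subr_eq0 addrAC subrr add0r (negbTE xi0).
have nm : v - xi <> v.
  by move=> /eqP; rewrite -subr_eq0 addrAC subrr add0r oppr_eq0 (negbTE xi0).
have := ltrD (Hu _ Sp np) (Hu _ Sm nm).
by rewrite mulmxDr mulmxBr !mxE addrACA subrr addr0 ltxx.
Qed.

(** Such a direction can be followed both ways inside the polyhedron, so [v] would be a midpoint. In
    other words, the active constraints and the equations have full column rank at a vertex. *)
Lemma vertex_direction0 (v xi : 'cV[R]_k) : vertex (hrep_set r) v ->
  (forall j, active v j -> (Am *m xi) j 0 = 0) -> Bm *m xi = 0 -> xi = 0.
Proof.
move=> vV Axi Bxi; have [Sv _] := vV.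
have [e [e0 He]] : exists e, 0 < e /\ forall t, 0 <= t -> t <= e -> hrep_set r (v + t *: xi).
  by apply: feasible_direction => // j /Axi ->.
have [f [f0 Hf]] : exists e, 0 < e /\ forall t, 0 <= t -> t <= e -> hrep_set r (v + t *: - xi).
  apply: feasible_direction => // [j /Axi H|]; last by rewrite mulmxN Bxi oppr0.
  by rewrite mulmxN mxE H oppr0.
pose t := Num.min e f.
have t0 : 0 < t by rewrite lt_min e0.
have : t *: xi = 0.
  apply: (vertex_not_midpoint vV).
    by apply: He; [apply: ltW|rewrite ge_min lexx].
  by rewrite -scalerN; apply: Hf; [apply: ltW|rewrite ge_min lexx orbT].
by move=> /eqP; rewrite scaler_eq0 gt_eqF //= => /eqP.
Qed.

Lemma vertex_active_inj v w : vertex (hrep_set r) v -> vertex (hrep_set r) w ->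
  active v =1 active w -> v = w.
Proof.
move=> vV wV vw; apply/eqP; rewrite -subr_eq0; apply/eqP.
have [/hrep_setP[_ Bv] _] := vV; have [/hrep_setP[_ Bw] _] := wV.
apply: (vertex_direction0 vV) => [j vj|]; last by rewrite mulmxBr Bv Bw subrr.
have := vj; rewrite vw => /eqP wj; move/eqP: vj => vj.
by rewrite mulmxBr !mxE; move: vj wj; rewrite !mxE => -> ->; rewrite subrr.
Qed.

(** A vertex is determined by its active constraints, so picking one for each of the finitely many
    index sets (and 0 where there is none) lists them all. *)
Lemma vertices_finite : exists s : seq 'cV[R]_k, forall v, vertex (hrep_set r) v -> v \in s.
Proof.
exists [seq xget 0 [set v | vertex (hrep_set r) v /\ active v =1 f]
  | f : {ffun 'I_m -> bool}] => v vV.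
have fE : active v =1 [ffun j => active v j] by move=> j; rewrite ffunE.
rewrite (_ : v = xget 0 [set w | vertex (hrep_set r) w /\ active w =1 [ffun j => active v j]]).
  by apply: map_f; rewrite mem_enum.
case: xgetP => [w _ [wV wE]|/(_ v)]; last by case.
by apply: vertex_active_inj => // j; rewrite wE fE.
Qed.

(** Dual form of [vertex_direction0], obtained from [farkas_eq] with an empty family of
    inequalities. Active constraints are treated as equations, so their coefficients carry no sign;
    inactive rows are replaced by the zero functional. *)
Lemma vertex_active_span v : vertex (hrep_set r) v -> forall i,
  exists (s : 'rV[R]_m) (t : 'rV[R]_n),
    (forall j, ~~ active v j -> s 0 j = 0) /\ delta_mx 0 i = s *m Am + t *m Bm.
Proof.
move=> vV i.
pose e (j : 'I_m + 'I_n) (x : 'cV[R]_k) : R := match j with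
  | inl j => if active v j then (Am *m x) j 0 else 0
  | inr j => (Bm *m x) j 0 end.
have [|||x _ Hx|v0 [w [_ E]]] :=
  @farkas_eq R 'cV[R]_k 'I_0 _ (fun _ _ => 0) e (fun x => ((delta_mx 0 i : 'rV[R]_k) *m x) 0 0).
- by case.
- move=> [j|j] /=; last exact: functional_mx.
  by rewrite /e; case: (active v j); [exact: functional_mx | exact: functional0].
- exact: functional_mx.
- rewrite (_ : x = 0) ?mulmx0 ?mxE //; apply: (vertex_direction0 vV).
    by move=> j vj; have := Hx (inl j); rewrite /= vj.
  by apply/colP => j; rewrite [RHS]mxE; exact: (Hx (inr j)).
exists (\row_j (if active v j then w (inl j) else 0)), (\row_j w (inr j)).
split=> [j vj|]; first by rewrite mxE (negbTE vj).
apply: row_ext => x; rewrite E big_ord0 add0r big_sumType mulmxDl -!mulmxA mxE /=.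
congr (_ + _); rewrite [in RHS]mxE; apply: eq_bigr => j _; rewrite [in RHS]mxE //.
by case: ifP => // _; rewrite mulr0 mul0r.
Qed.

End Polyhedra.

(** This induction and the evaluation homomorphisms are all that the abstract sections below use of
    the multivariate polynomial ring. *)
Lemma mpoly_gen_ind (R : realType) (N : nat) (P : {mpoly R[N]} -> Prop) :
  (forall r, P r%:MP) -> (forall i, P 'X_i) ->
  (forall a b, P a -> P b -> P (a + b)) ->
  (forall a b, P a -> P b -> P (a * b)) -> forall a, P a.
Proof.
move=> PC PX PD PM; apply: mpolyind => [|r m a _ _ Pa]; first exact: (PC 0).
apply: PD => //; rewrite -mul_mpolyC; apply: (PM) => //; rewrite mpolyXE_id.
apply: (big_ind P) => [|a1 a2|i _]; [exact: (PC 1)|exact: PM|].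
by elim: (m i) => [|j IH]; [exact: (PC 1)|rewrite exprS; apply: (PM)].
Qed.

(** * Point derivations, separation of points and archimedean modules *)

Section PointDerivations.
Variables (R : realType) (N : nat) (A : comNzRingType) (C : {rmorphism R -> A}).
Variables (X_ : 'I_N -> A) (ev : ('I_N -> R) -> {rmorphism A -> R}).
Hypothesis evC : forall x r, ev x (C r) = r.
Hypothesis evX : forall x i, ev x (X_ i) = x i.
Hypothesis gen_ind : forall P : A -> Prop,
  (forall r, P (C r)) -> (forall i, P (X_ i)) ->
  (forall a b, P a -> P b -> P (a + b)) ->
  (forall a b, P a -> P b -> P (a * b)) -> forall a, P a.

Definition point_derivation (x : 'I_N -> R) (psi : A -> R) : Prop :=
  [/\ forall a b, psi (a + b) = psi a + psi b, forall r, psi (C r) = 0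
    & forall a b, psi (a * b) = ev x a * psi b + psi a * ev x b].

Lemma point_derivation0 x psi : point_derivation x psi ->
  (forall i, psi (X_ i) = 0) -> forall a, psi a = 0.
Proof.
move=> [pD pC pM] pX; apply: gen_ind => // [a b|a b].
  by rewrite pD => -> ->; rewrite addr0.
by rewrite pM => -> ->; rewrite mulr0 mul0r addr0.
Qed.

(** Induction: to the form [a] for the tail add [e] times a coordinate [i] with [v i] nonzero. Each
    [w] with [w i] nonzero excludes a single value of [e]; the other vectors lie in the tail and
    keep their value under [a]. *)
Lemma separating_form (s : seq ('I_N -> R)) :
  (forall v, List.In v s -> exists i, v i != 0) ->
  exists a : 'I_N -> R, forall v, List.In v s -> \sum_i a i * v i != 0.
Proof.
elim: s => [|v s IH] H; first by exists (fun=> 0).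
have [|a Ha] := IH; first by move=> w ws; apply: H; right.
have [i vi] := H v (or_introl erefl).
pose bad := 0 :: [seq - (\sum_j a j * (w : 'I_N -> R) j) / w i | w <- v :: s].
have [e be] : exists e, e \notin bad.
  (* This number exceeds the absolute value of every member of [bad]. *)
  exists (1 + \sum_(b <- bad) `|b|); apply/negP => /[dup] eb.
  rewrite -index_mem => _; have := ler_norm (1 + \sum_(b <- bad) `|b|).
  suff : `|1 + \sum_(b <- bad) `|b| | <= \sum_(b <- bad) `|b|.
    by move=> /(le_trans (ler_norm _)); rewrite gerDr leNgt ltr01.
  rewrite [leRHS](big_rem _ eb) /= lerDl sumr_ge0 //.
exists (fun j => a j + e *+ (j == i)) => w ws.
have -> : \sum_j (a j + e *+ (j == i)) * w j = \sum_j a j * w j + e * w i.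
  under eq_bigr => j _ do rewrite mulrDl.
  rewrite big_split /=; congr (_ + _).
  rewrite (bigD1 i) //= eqxx mulr1n big1 ?addr0 //.
  by move=> j /negbTE ->; rewrite mulr0n mul0r.
have [w0|w0] := eqVneq (w i) 0.
  rewrite w0 mulr0 addr0; case: ws => [vw|]; last exact: Ha.
  by rewrite vw w0 eqxx in vi.
apply: contraNneq be => E; rewrite inE; apply/orP; right.
have -> : e = - (\sum_j a j * w j) / w i.
  by apply: (mulIf w0); rewrite divfK //; apply/eqP; rewrite -subr_eq0 opprK addrC E.
elim: (v :: s) ws => [//|t l IHl] /= [->|/IHl]; first by rewrite inE eqxx.
by rewrite inE => ->; rewrite orbT.
Qed.

Lemma separating_poly (K : nat) (X : 'I_K -> 'I_N -> R) :
  (forall k l, k != l -> exists i, X k i != X l i) ->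
  exists f : A, forall k l, k != l -> ev (X k) f != ev (X l) f.
Proof.
move=> Xd.
pose s := [seq (fun i => X kl.1 i - X kl.2 i)
  | kl <- [seq kl <- enum {: 'I_K * 'I_K} | kl.1 != kl.2]].
have sIn k l : k != l -> List.In (fun i => X k i - X l i) s.
  move=> kl; rewrite /s.
  have : (k, l) \in [seq kl <- enum {: 'I_K * 'I_K} | kl.1 != kl.2].
    by rewrite mem_filter mem_enum kl.
  elim: [seq _ <- _ | _] => [//|t u IH] /=.
  by rewrite inE => /orP[/eqP <-|/IH]; [left|right].
have [|a Ha] := @separating_form s.
  rewrite /s; elim: (enum _) => [//|t u IH] /= v.
  case: ifP => [kl|_]; last exact: IH.
  move=> /= [<-|]; last exact: IH.
  by have [i] := Xd _ _ kl; exists i; rewrite subr_eq0.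
exists (\sum_i C (a i) * X_ i) => k l kl.
have evE j : ev (X j) (\sum_i C (a i) * X_ i) = \sum_i a i * X j i.
  by rewrite rmorph_sum; apply: eq_bigr => i _; rewrite /= rmorphM evC evX.
rewrite !evE -subr_eq0 -sumrB.
by under eq_bigr => i _ do rewrite -mulrBr; apply: Ha; apply: sIn.
Qed.

Variable M : A -> Prop.
Hypothesis MM : quadratic_module M.
Local Notation dom := (dominated C M).

Let M1 : M 1. Proof. by case: MM. Qed.
Let SM : square_module M. Proof. by case: MM. Qed.

Lemma dominated_trans u v b : M (v - u) -> dom u b -> M u -> dom v b.
Proof.
move=> Mvu uJ Mu; have [K HK] := dominatedP SM Mu uJ.
have [] := HK (Num.max K 0) (ltac:(by rewrite le_max lexx)).
set k := Num.max K 0 => H1 H2.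
have := @square_moduleZ R _ C M k (v - u) SM (ltac:(by rewrite le_max lexx orbT)) Mvu.
move=> H3; exists k; split.
  by rewrite (_ : _ - b = (C k * u - b) + C k * (v - u)); [apply: SM.1|ring].
by rewrite (_ : _ + b = (C k * u + b) + C k * (v - u)); [apply: SM.1|ring].
Qed.

Lemma dominated_scale a u b : dom u b -> dom (a ^+ 2 * u) (a ^+ 2 * b).
Proof.
move=> [K [K1 K2]]; exists K; have := SM.2 a _ K1; have := SM.2 a _ K2.
move=> H2 H1; split.
  by rewrite (_ : _ - _ = a ^+ 2 * (C K * u - b)) //; ring.
by rewrite (_ : _ + _ = a ^+ 2 * (C K * u + b)) //; ring.
Qed.

(** The identity 2 k (k^2 - a^2) = (k + a)^2 (k - a) + (k - a)^2 (k + a) uses only multiplication by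
    squares. *)
Lemma dominated_square a : dom 1 a -> dom 1 (a ^+ 2).
Proof.
move=> /(dominatedP SM M1)[K HK].
pose k := Num.max K 1.
have [H1 H2] := HK k (ltac:(by rewrite le_max lexx)).
have k0 : 0 < k by rewrite lt_max ltr01 orbT.
apply: (@dominated_le _ _ C _ _ SM M1 _ (C (k ^+ 2) * 1)).
- by apply: dominatedZ => //; apply: dominated_unit.
- by rewrite -[_ ^+ 2]mulr1; apply: SM.2.
- rewrite (_ : _ - _ = C (2 * k)^-1 *
    ((C k + a) ^+ 2 * (C k * 1 - a) + (C k - a) ^+ 2 * (C k * 1 + a))).
    apply: (@square_moduleZ R) => //; first by rewrite invr_ge0 mulr_ge0 // ltW.
    by apply: SM.1; apply: SM.2.
  rewrite (_ : _ + _ = C (2 * k) * (C (k ^+ 2) - a ^+ 2)).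
    have -> : C (2 * k)^-1 * (C (2 * k) * (C (k ^+ 2) - a ^+ 2)) =
        C ((2 * k)^-1 * (2 * k)) * (C (k ^+ 2) - a ^+ 2) by rewrite [in RHS]rmorphM -mulrA.
    by rewrite mulVf ?rmorph1 ?mul1r ?mulr1 // gt_eqF // mulr_gt0.
  rewrite rmorphXn rmorphM (rmorph_nat C 2); ring.
Qed.

(** Multiplication by any element preserves boundedness, by induction over the ring; for a generator
    this is [dominatedM], whose premise is supplied by [dominated_square]. *)
Lemma archimedean : (forall i, dom 1 (X_ i)) -> forall a, dom 1 a.
Proof.
move=> XJ; suff H : forall a b, dom 1 b -> dom 1 (a * b).
  by move=> a; rewrite -[a]mulr1; apply: H; apply: dominated_unit.
apply: gen_ind => [r b|i b bJ|a1 a2 H1 H2 b bJ|a1 a2 H1 H2 b bJ].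
- by move=> bJ; apply: dominatedZ.
- by apply: dominatedM => //; rewrite mulr1; apply: dominated_square.
- by rewrite mulrDl; apply: dominatedD; [|apply: H1|apply: H2].
- by rewrite -mulrA; apply: H1; apply: H2.
Qed.

(* Near a point where all [y i] vanish, [N - x^2] is a square up to
   [y^4 / k^2], where [y = x - x0]; multiplied by [g], this error term is
   absorbed by the summand [y i ^+ 2] of the multiplier. *)
Lemma dominated_local (I : finType) (y : I -> A) (g : A) i x0 :
  (forall a, dom 1 a) -> M g ->
  dom (g + \sum_l y l ^+ 2)
    ((y i + C x0) ^+ 2 * (g + \sum_l y l ^+ 2)).
Proof.
move=> arch Mg.
set S := \sum_l _; pose x := y i + C x0.
have SS : sum_of_squares S.
  by exists [seq y l | l <- enum I]; rewrite big_map big_enum.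
have MS : M S by apply: quadratic_module_sos.
have Mgs : M (g + S) by apply: SM.1.
have [K1 HK1] := dominatedP SM M1 (arch (g * y i ^+ 2)).
have [K2 HK2] := dominatedP SM M1 (arch (x ^+ 2)).
pose k := Num.max 1 K1; pose rho := Num.max 0 K2.
have k1 : 1 <= k by rewrite le_max lexx.
have k0 : 0 < k by apply: lt_le_trans k1.
have r0 : 0 <= rho by rewrite le_max lexx.
have [Hk _] : M (C (k ^+ 2) * 1 - g * y i ^+ 2) /\ M (C (k ^+ 2) * 1 + g * y i ^+ 2).
  apply: HK1; apply: (@le_trans _ _ k); first by rewrite le_max lexx orbT.
  by rewrite expr2 ler_peMl // ltW.
have [Hr _] := HK2 rho (ltac:(by rewrite le_max lexx orbT)).
pose N1 := 2 * x0 ^+ 2 + k ^+ 2.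
have N10 : 0 <= N1 by rewrite addr_ge0 ?sqr_ge0 // mulr_ge0 // sqr_ge0.
apply: (@dominated_le _ _ C _ _ SM Mgs _ (C (N1 + (rho + 1)) * (g + S))).
- by apply: dominatedZ => //; apply: dominated_unit.
- exact: SM.2.
have kk : C k^-1 * C k = 1 by rewrite -rmorphM mulVf ?rmorph1 // gt_eqF.
pose S' := \sum_(l | l != i) y l ^+ 2.
have SE : S = y i ^+ 2 + S' by rewrite /S (bigD1 i).
have SS' : M S'.
  apply: quadratic_module_sos => //.
  by exists [seq y l | l <- enum I & l != i]; rewrite big_map big_filter big_enum_cond.
have -> : C (N1 + (rho + 1)) * (g + S) - (y i + C x0) ^+ 2 * (g + S) =
   (C k^-1 * y i ^+ 2 - C k) ^+ 2 * g + (C x0 - y i) ^+ 2 * g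
   + C (rho + 1) * g + C N1 * S + S * (C rho * 1 - x ^+ 2)
   + S' + y i ^+ 2 * (C k^-1 ^+ 2 * (C (k ^+ 2) * 1 - g * y i ^+ 2)).
  have -> : (C k^-1 * y i ^+ 2 - C k) ^+ 2 * g =
     C k^-1 ^+ 2 * y i ^+ 4 * g - (C k^-1 * C k) * 2 * y i ^+ 2 * g + C k ^+ 2 * g.
    by ring.
  have -> : C k^-1 ^+ 2 * (C (k ^+ 2) * 1 - g * y i ^+ 2) =
     (C k^-1 * C k) ^+ 2 - C k^-1 ^+ 2 * g * y i ^+ 2.
    by rewrite rmorphXn; ring.
  have -> : C N1 = 2 * C x0 ^+ 2 + C k ^+ 2.
    by rewrite rmorphD rmorphM !rmorphXn (rmorph_nat C 2).
  by rewrite kk !rmorphD rmorph1 /x SE; ring.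
repeat apply: SM.1 => //; try exact: SM.2.
- by apply: square_moduleZ => //; rewrite addr_ge0.
- exact: square_moduleZ.
- by apply: square_module_sos.
- by apply: SM.2; apply: SM.2.
Qed.

Definition poly_at (f : A) (q : {poly R}) : A := (map_poly C q).[f].

Lemma poly_atM f q1 q2 : poly_at f (q1 * q2) = poly_at f q1 * poly_at f q2.
Proof. by rewrite /poly_at rmorphM hornerM. Qed.

Lemma poly_atD f q1 q2 : poly_at f (q1 + q2) = poly_at f q1 + poly_at f q2.
Proof. by rewrite /poly_at rmorphD hornerD. Qed.

Lemma poly_atX f q n : poly_at f (q ^+ n) = poly_at f q ^+ n.
Proof. by rewrite /poly_at rmorphXn horner_exp. Qed.

Lemma poly_at_sum f (I : finType) (F : I -> {poly R}) :
  poly_at f (\sum_i F i) = \sum_i poly_at f (F i).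
Proof. by rewrite /poly_at rmorph_sum horner_sum. Qed.

Lemma poly_atC f r : poly_at f r%:P = C r.
Proof. by rewrite /poly_at map_polyC hornerC. Qed.

Lemma ev_poly_at x f q : ev x (poly_at f q) = q.[ev x f].
Proof.
rewrite /poly_at -horner_map -map_poly_comp; congr (_.[_]).
by rewrite map_poly_id // => r _; apply: evC.
Qed.

(** At the node [t k] only [e k] survives, so the sum of squares is nonzero at every root of [w] and
    therefore coprime to [w ^+ 2]. *)
Lemma lagrange_bezout (K : nat) (t : 'I_K -> R) : injective t ->
  let e k := \prod_(l | l != k) ('X - (t l)%:P) in
  let w := \prod_l ('X - (t l)%:P) in
  exists f h, f * (\sum_k e k ^+ 2) + h * w ^+ 2 = 1.
Proof.
move=> tI e w.
have esq k l : l != k -> (e l).[t k] = 0.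
  by move=> lk; rewrite horner_prod (bigD1 k) 1?eq_sym //= hornerXsubC subrr mul0r.
have eneq k : (e k).[t k] != 0.
  rewrite horner_prod; apply/prodf_neq0 => l lk.
  by rewrite hornerXsubC subr_eq0 (inj_eq tI) eq_sym.
have : coprimep (\sum_k e k ^+ 2) (w ^+ 2).
  apply: coprimep_expr; apply: (big_ind (coprimep (\sum_k e k ^+ 2))) => [|q1 q2 H1 H2|k _].
    exact: coprimep1.
    by rewrite coprimepMr H1.
  rewrite coprimep_XsubC rootE horner_sum (bigD1 k) //= big1 => [|l lk].
    by rewrite addr0 horner_exp sqrf_eq0 eneq.
  by rewrite horner_exp esq // expr0n.
move=> /Bezout_eq1_coprimepP[[f h] /= E]; exists f, h; exact: E.
Qed.

(** * Membership of an element with finitely many zeros in an archimedean module *)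

Section Membership.
Variables (K : nat) (X : 'I_K -> 'I_N -> R) (g : 'I_K -> A) (p : A).
Hypothesis X_distinct : forall k l, k != l -> exists i, X k i != X l i.
Hypothesis arch : forall i, dom 1 (X_ i).
Hypothesis gM : forall k, M (g k).
Hypothesis gX : forall k, ev (X k) (g k) = 0.
Hypothesis g_dom : forall k i, dom (g k) (X_ i - C (X k i)).
Hypothesis pX : forall k, ev (X k) p = 0.
Hypothesis p_zero : forall x, (forall m, M m -> 0 <= ev x m) -> ev x p <= 0 ->
  exists k, forall i, x i = X k i.
Hypothesis p_deriv : forall k psi, point_derivation (X k) psi ->
  (forall m, M m -> ev (X k) m = 0 -> 0 <= psi m) -> psi p <= 0 ->
  forall i, psi (X_ i) = 0.

Section Multiplier.
Variable f : A.
Hypothesis f_sep : forall k l, k != l -> ev (X k) f != ev (X l) f.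

Let e (k : 'I_K) : A := poly_at f (\prod_(l | l != k) ('X - (ev (X l) f)%:P)).
Let w : A := poly_at f (\prod_l ('X - (ev (X l) f)%:P)).
Let y k i : A := X_ i - C (X k i).
Let v k : A := g k + \sum_i y k i ^+ 2.

(** The u of the overview; [e k] and [w] are univariate polynomials in the separating element
    [f]. *)
Definition order_unit : A := \sum_k e k ^+ 2 * v k + w ^+ 2.

Local Notation u := order_unit.

Let archA : forall a, dom 1 a. Proof. exact: archimedean. Qed.

Let vM k : M (v k).
Proof.
apply: SM.1 => //; apply: quadratic_module_sos => //.
by exists [seq y k i | i <- enum 'I_N]; rewrite big_map big_enum.
Qed.

Let sqM a : M (a ^+ 2).
Proof. by rewrite -[_ ^+ 2]mulr1; apply: SM.2. Qed.

Let sumM (I : Type) (s : seq I) (P : pred I) (F : I -> A) :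
  (forall i, M (F i)) -> M (\sum_(i <- s | P i) F i).
Proof.
move=> MF; apply: big_ind => //; last by move=> a b; apply: SM.1.
by apply: square_module0 SM M1.
Qed.

Let M_e k : M (u - e k ^+ 2 * v k).
Proof.
rewrite /u (bigD1 k) //=; set s := \sum_(_ | _) _.
rewrite (_ : _ - _ = s + w ^+ 2); last by ring.
by apply: SM.1 => //; apply: sumM => l; apply: SM.2.
Qed.

Let M_w : M (u - w ^+ 2).
Proof. by rewrite /u addrK; apply: sumM => l; apply: SM.2. Qed.

Lemma order_unit_mem : M u.
Proof. by apply: SM.1 => //; apply: sumM => l; apply: SM.2. Qed.

(** For a generator it suffices, by [dominatedM], to bound [X_ i ^+ 2 * u]. The summands
    [e k ^+ 2 * v k] are handled by [dominated_local], the summand [w ^+ 2] by archimedeanness. *)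
Lemma order_unit_ideal a b : dom u b -> dom u (a * b).
Proof.
have uM := order_unit_mem.
move: a b; apply: gen_ind => [r b|i b bJ|a1 a2 H1 H2 b bJ|a1 a2 H1 H2 b bJ].
- exact: dominatedZ.
- apply: dominatedM => //; rewrite {2}/u mulrDr mulr_sumr; apply: dominatedD => //.
    apply: dominated_sum => // k.
    apply: (dominated_trans (M_e k)); last exact: SM.2.
    rewrite mulrCA; apply: dominated_scale.
    have -> : X_ i = y k i + C (X k i) by rewrite /y subrK.
    exact: dominated_local.
  apply: (dominated_trans M_w) => //.
  rewrite mulrC -[X in dom X]mulr1; apply: dominated_scale.
  exact: dominated_square.
- by rewrite mulrDl; apply: dominatedD; [|apply: H1|apply: H2].
- by rewrite -mulrA; apply: H1; apply: H2.
Qed.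

Let eyJ k i : dom u (e k ^+ 2 * y k i).
Proof.
apply: (dominated_trans (M_e k)); last exact: SM.2.
apply: dominated_scale; apply: (dominated_trans _ (g_dom k i)) => //.
rewrite /v addrAC subrr add0r; exact: sumM.
Qed.

(** For generators this comes from [g_dom]; the identity a b - a0 b0 = a (b - b0) + b0 (a - a0)
    propagates it to products. It keeps the arguments of [phi] in the derivation [psi] below inside
    the ideal. *)
Let eJ k a : dom u (e k ^+ 2 * (a - C (ev (X k) a))).
Proof.
have uM := order_unit_mem.
move: a; apply: gen_ind => [r|i|a b aJ bJ|a b aJ bJ].
- by rewrite evC subrr mulr0; apply: dominated0.
- rewrite evX; exact: eyJ.
- rewrite rmorphD rmorphD (_ : _ * _ = e k ^+ 2 * (a - C (ev (X k) a))
     + e k ^+ 2 * (b - C (ev (X k) b))); last by ring.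
  exact: dominatedD.
- rewrite rmorphM rmorphM (_ : _ * _ = a * (e k ^+ 2 * (b - C (ev (X k) b)))
     + C (ev (X k) b) * (e k ^+ 2 * (a - C (ev (X k) a)))); last by ring.
  by apply: dominatedD; [|apply: order_unit_ideal|apply: dominatedZ].
Qed.

Let wJ : dom u (w ^+ 2).
Proof. by apply: (dominated_trans M_w) => //; apply: dominated_unit. Qed.

(** Multiply [p] by the Bezout identity for the squares of the [e k] and of [w]. As [p] vanishes at
    each [X k], the first part consists of multiples of elements covered by [eJ]; the second is a
    multiple of [w ^+ 2]. *)
Let pJ : dom u p.
Proof.
have uM := order_unit_mem.
have t_inj : injective (fun k => ev (X k) f).
  by move=> k l /eqP kl; apply/eqP; apply: contraTT kl; apply: f_sep.
have [a [b /= E]] := lagrange_bezout t_inj.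
have -> : p = poly_at f a * (\sum_k e k ^+ 2 * (p - C (ev (X k) p))) +
    poly_at f b * p * w ^+ 2.
  have E1 : poly_at f a * (\sum_k e k ^+ 2) + poly_at f b * w ^+ 2 = 1.
    have -> : \sum_k e k ^+ 2 =
        poly_at f (\sum_k (\prod_(l | l != k) ('X - (ev (X l) f)%:P)) ^+ 2).
      by rewrite poly_at_sum; apply: eq_bigr => k _; rewrite poly_atX.
    by rewrite -poly_atX -!poly_atM -poly_atD E poly_atC rmorph1.
  have -> : \sum_k e k ^+ 2 * (p - C (ev (X k) p)) = (\sum_k e k ^+ 2) * p.
    by rewrite mulr_suml; apply: eq_bigr => k _; rewrite pX rmorph0 subr0.
  by rewrite -[LHS]mul1r -E1; ring.
apply: dominatedD => //; apply: order_unit_ideal => //.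
by apply: dominated_sum => // k; apply: eJ.
Qed.

Lemma membership_separated : M p.
Proof.
have uM := order_unit_mem; have uJ := @dominated_unit _ _ C _ _ SM uM.
apply: contrapT => nMp.
have [phi [phi0 phip phiD phic phiM]] :=
  exists_multiplicative_state SM uM order_unit_ideal pJ nMp.
have aJ a : dom u (a * u) by apply: order_unit_ideal.
(* After multiplication by [u] the state is a ring homomorphism, hence evaluation at this point. *)
pose x i := phi (X_ i * u).
have phiE a : phi (a * u) = ev x a.
  move: a; apply: gen_ind => [r|i|a b Ha Hb|a b Ha Hb].
  - by rewrite phic evC.
  - by rewrite evX.
  - by rewrite mulrDl phiD // Ha Hb rmorphD.
  - by rewrite -mulrA phiM // Ha Hb rmorphM.
have {}phiM a b : dom u b -> phi (a * b) = ev x a * phi b.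
  by move=> bJ; rewrite phiM // phiE.
(* If [phi (a ^+ 2)] is positive, dividing by it transfers nonnegativity on [M] and [phi p <= 0] to
   evaluation at [x], so [p_zero] applies. If it is 0, multiplying by [u] shows that [a] vanishes at
   [x]. *)
have atX a : dom u (a ^+ 2) -> (exists k, forall i, x i = X k i) \/ ev x a = 0.
  move=> a2J; have a20 : 0 <= phi (a ^+ 2) by apply: phi0.
  move: a20; rewrite le_eqVlt => /orP[/eqP a20|a20]; [right|left].
    apply/eqP; rewrite -sqrf_eq0 -rmorphXn -phiE; apply/eqP.
    by rewrite mulrC phiM // -a20 mulr0.
  apply: p_zero => [m Mm|].
    rewrite -(pmulr_lge0 _ a20) -phiM //; apply: phi0; last exact: order_unit_ideal.
    by rewrite mulrC; apply: SM.2.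
  rewrite -(pmulr_lle0 _ a20) -phiM // mulrC (phiM _ _ pJ) rmorphXn.
  by rewrite mulr_ge0_le0 // sqr_ge0.
(* Testing with [w] yields a [k] such that [f] agrees at [x] and [X k]. Then [e k] is nonzero at
   [x], and testing with [e k * y k i] identifies the coordinates. *)
have [k xk] : exists k, forall i, x i = X k i.
  have [//|] := atX w wJ.
  rewrite /w ev_poly_at horner_prod => /eqP/prodf_eq0[k _].
  rewrite hornerXsubC subr_eq0 => /eqP xk.
  have ek : ev x (e k) != 0.
    rewrite /e ev_poly_at horner_prod; apply/prodf_neq0 => l lk.
    by rewrite hornerXsubC subr_eq0 xk f_sep // eq_sym.
  apply: contrapT => nx; apply: (nx); exists k => i.
  have [|[l xl]|] := atX (e k * y k i).
  - rewrite (_ : _ ^+ 2 = y k i * (e k ^+ 2 * y k i)); last by ring.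
    by apply: order_unit_ideal; apply: eyJ.
  - by case: nx; exists l.
  - move=> /eqP; rewrite rmorphM mulf_eq0 (negbTE ek) /= rmorphB evX evC subr_eq0.
    by move=> /eqP.
have evx a : ev x a = ev (X k) a.
  move: a; apply: gen_ind => [r|i|a b Ha Hb|a b Ha Hb].
  - by rewrite !evC.
  - by rewrite !evX.
  - by rewrite !rmorphD Ha Hb.
  - by rewrite !rmorphM Ha Hb.
pose psi a := phi (e k ^+ 2 * (a - C (ev (X k) a))).
have phi_0 : phi 0 = 0 by have := phic 0; rewrite rmorph0 mul0r.
have psiP : point_derivation (X k) psi.
  split=> [a b|r|a b]; rewrite /psi.
  - rewrite -phiD //; congr phi; rewrite !rmorphD; ring.
  - by rewrite evC subrr mulr0.
  - rewrite (_ : _ * _ = a * (e k ^+ 2 * (b - C (ev (X k) b)))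
      + C (ev (X k) b) * (e k ^+ 2 * (a - C (ev (X k) a)))); last by rewrite !rmorphM; ring.
    rewrite phiD //; [|exact: order_unit_ideal|exact: order_unit_ideal].
    rewrite (phiM a _ (eJ k b)) (phiM _ _ (eJ k a)) evC evx.
    by congr (_ + _); rewrite mulrC.
have e_gt0 : 0 < ev (X k) (e k ^+ 2).
  rewrite rmorphXn exprn_even_gt0 //= /e ev_poly_at horner_prod.
  by apply/prodf_neq0 => l lk; rewrite hornerXsubC subr_eq0 f_sep // eq_sym.
have psi_vanish a : dom u a -> ev (X k) a = 0 -> psi a = ev (X k) (e k ^+ 2) * phi a.
  by move=> aJ' a0; rewrite /psi a0 rmorph0 subr0 phiM // evx.
have psiX : forall i, psi (X_ i) = 0.
  apply: (p_deriv psiP) => [m Mm m0|].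
    apply: phi0 => //; rewrite m0 rmorph0 subr0; exact: SM.2.
  by rewrite psi_vanish // mulr_ge0_le0 // ltW.
(* Since [u] vanishes at [X k], [psi u] is a positive multiple of [phi u = 1], whereas [psi] is 0
   because it kills all generators. *)
have u0 : ev (X k) u = 0.
  have w0 : ev (X k) w = 0.
    by rewrite /w ev_poly_at horner_prod (bigD1 k) //= hornerXsubC subrr mul0r.
  rewrite rmorphD rmorphXn w0 expr0n addr0 rmorph_sum big1 // => l _.
  rewrite rmorphM rmorphXn; have [->|lk] := eqVneq l k.
    rewrite rmorphD gX add0r rmorph_sum [X in _ * X]big1 ?mulr0 // => i _.
    by rewrite /= rmorphXn rmorphB /= evX evC subrr expr0n.
  rewrite /e ev_poly_at horner_prod (bigD1 k) 1?eq_sym //=.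
  by rewrite hornerXsubC subrr mul0r expr0n mul0r.
have := psi_vanish u uJ u0; rewrite (point_derivation0 psiP psiX).
have -> : phi u = 1 by have := phic 1; rewrite rmorph1 mul1r.
by rewrite mulr1 => /esym/eqP; rewrite gt_eqF.
Qed.

End Multiplier.

Theorem membership : M p.
Proof.
by have [f fX] := separating_poly X_distinct; apply: (membership_separated fX).
Qed.

End Membership.
End PointDerivations.

(** * The module generated by inequalities and equations, without degree bounds *)

Section GeneratedModule.
Variables (A : comNzRingType) (I J : finType) (g : I -> A) (h : J -> A).

Definition generated_module (a : A) : Prop :=
  exists (s0 : A) (s : I -> A) (t : J -> A),
    [/\ sum_of_squares s0, forall i, sum_of_squares (s i)
      & a = s0 + \sum_i s i * g i + \sum_j t j * h j].

Lemma generated_module_quadratic : quadratic_module generated_module.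
Proof.
split; last split.
- exists (1 ^+ 2), (fun=> 0), (fun=> 0); split; first exact: sum_of_squaresX.
    by move=> i; apply: sum_of_squares0.
  by rewrite !big1 ?addr0 ?expr1n // => i _; rewrite mul0r.
- move=> a b [s0 [s [t [S0 Ss ->]]]] [u0 [u [v [U0 Us ->]]]].
  exists (s0 + u0), (fun i => s i + u i), (fun j => t j + v j); split.
  + exact: sum_of_squaresD.
  + by move=> i; apply: sum_of_squaresD.
  + under [in RHS]eq_bigr => i _ do rewrite mulrDl.
    under [X in _ = _ + X]eq_bigr => i _ do rewrite mulrDl.
    rewrite !big_split /=; ring.
- move=> a b [s0 [s [t [S0 Ss ->]]]].
  exists (a ^+ 2 * s0), (fun i => a ^+ 2 * s i), (fun j => a ^+ 2 * t j); split.
  + exact: sum_of_squaresM.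
  + by move=> i; apply: sum_of_squaresM.
  + rewrite !mulrDr !mulr_sumr.
    by congr (_ + _ + _); apply: eq_bigr => i _; rewrite mulrA.
Qed.

Lemma generated_module_ineq i : generated_module (g i).
Proof.
exists 0, (fun j => if j == i then 1 ^+ 2 else 0), (fun=> 0); split.
- exact: sum_of_squares0.
- by move=> j; case: ifP => _; [exact: sum_of_squaresX|exact: sum_of_squares0].
- rewrite (bigD1 i) //= eqxx expr1n mul1r !big1 ?add0r ?addr0 // => j.
    by rewrite mul0r.
  by move=> /negbTE ->; rewrite mul0r.
Qed.

Lemma generated_module_eq f j : generated_module (f * h j).
Proof.
exists 0, (fun=> 0), (fun i => if i == j then f else 0); split.
- exact: sum_of_squares0.
- by move=> i; apply: sum_of_squares0.
- rewrite [X in _ = _ + X](bigD1 j) //= eqxx !big1 ?add0r ?addr0 // => i.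
    by move=> /negbTE ->; rewrite mul0r.
  by rewrite mul0r.
Qed.

Lemma generated_module_ge0 (R : realDomainType) (f : {rmorphism A -> R}) a :
  (forall i, 0 <= f (g i)) -> (forall j, f (h j) = 0) ->
  generated_module a -> 0 <= f a.
Proof.
move=> fg fh [s0 [s [t [S0 Ss ->]]]].
have sos_ge0 b : sum_of_squares b -> 0 <= f b.
  by move=> [l ->]; rewrite rmorph_sum sumr_ge0 // => c _; rewrite rmorphXn sqr_ge0.
rewrite !rmorphD !rmorph_sum [X in _ + X]big1 ?addr0 => [|j _].
  rewrite addr_ge0 ?sos_ge0 // sumr_ge0 // => i _.
  by rewrite rmorphM mulr_ge0 // sos_ge0.
by rewrite rmorphM fh mulr0.
Qed.

End GeneratedModule.

(** * Linear certificates from Farkas multipliers *)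

Section Certificates.
Variables (R : realType) (A : comNzRingType) (C : {rmorphism R -> A}).
Variables (M : A -> Prop) (MQ : quadratic_module M).
Variables (k m n : nat) (r : hrep R k m n) (y : 'cV[A]_k).

Definition ineq_at (j : 'I_m) : A :=
  (map_mx C (ineq_rhs r) - map_mx C (ineq_mx r) *m y) j 0.
Definition eq_at (j : 'I_n) : A :=
  (map_mx C (eq_rhs r) - map_mx C (Defs.eq_mx r) *m y) j 0.

Hypothesis ineqM : forall j, M (ineq_at j).
Hypothesis eqM : forall f j, M (f * eq_at j).

Let M1 : M 1. Proof. by case: MQ. Qed.
Let SM : square_module M. Proof. by case: MQ. Qed.

Let sumM (I : Type) (s : seq I) (P : pred I) (F : I -> A) :
  (forall i, P i -> M (F i)) -> M (\sum_(i <- s | P i) F i).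
Proof.
move=> MF; apply: (big_ind M) => //; last by move=> a b; apply: SM.1.
by apply: square_module0 SM M1.
Qed.

Lemma row_combination (s : 'rV[R]_m) (t : 'rV[R]_n) :
  ((map_mx C (s *m ineq_rhs r + t *m eq_rhs r)) -
     map_mx C (s *m ineq_mx r + t *m Defs.eq_mx r) *m y) 0 0 =
  \sum_j C (s 0 j) * ineq_at j + \sum_j C (t 0 j) * eq_at j.
Proof.
rewrite !map_mxD !map_mxM mulmxDl opprD addrACA -!mulmxA -!mulmxBr mxE.
by congr (_ + _); rewrite mxE; apply: eq_bigr => j _; rewrite mxE.
Qed.

(** The Farkas multipliers of the inequalities and the remaining slack are nonnegative reals, hence
    squares, so the affine identity is already a certificate in [M]. *)
Lemma affine_certificate (u : 'rV[R]_k) dl : hrep_set r !=set0 ->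
  (forall x, hrep_set r x -> (u *m x) 0 0 <= dl) ->
  M (C dl - (map_mx C u *m y) 0 0).
Proof.
move=> rn0 /(affine_farkas rn0)[s [t [s0 uE dlE]]].
have := row_combination s t; rewrite -uE mxE [X in _ + X]mxE mxE => E.
rewrite (_ : _ - _ = C (dl - (s *m ineq_rhs r + t *m eq_rhs r) 0 0) +
  (\sum_j C (s 0 j) * ineq_at j + \sum_j C (t 0 j) * eq_at j)); last first.
  by rewrite -E rmorphB; ring.
apply: SM.1; first by apply: quadratic_module_c => //; rewrite subr_ge0.
by apply: SM.1; apply: sumM => j _ //; apply: square_moduleZ.
Qed.

(** Boundedness enters the algebra here: upper bounds on a coordinate and on its negative are
    affine, hence certified. *)
Lemma coordinate_dominated i : hrep_set r !=set0 -> bounded (hrep_set r) ->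
  dominated C M 1 (y i 0).
Proof.
move=> rn0 [K HK]; exists K; rewrite mulr1.
have rowE : (map_mx C (delta_mx 0 i : 'rV[R]_k) *m y) 0 0 = y i 0.
  by rewrite map_delta_mx -rowE mxE.
have rowR (x : 'cV[R]_k) : ((delta_mx 0 i : 'rV[R]_k) *m x) 0 0 = x i 0.
  by rewrite -matrix.rowE mxE.
split.
  have := @affine_certificate (delta_mx 0 i) K rn0; rewrite rowE; apply=> x Sx.
  by rewrite rowR; apply: le_trans (ler_norm _) _; apply: HK.
have := @affine_certificate (- delta_mx 0 i) K rn0.
rewrite map_mxN mulNmx mxE rowE opprK; apply=> x Sx.
rewrite mulNmx mxE rowR; apply: le_trans (ler_norm _) _; rewrite normrN.
exact: HK.
Qed.

Definition active_sum (v : 'cV[R]_k) : A := \sum_(j | active r v j) ineq_at j.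

Lemma active_sum_mem v : M (active_sum v).
Proof. exact: sumM. Qed.

(** By [vertex_active_span] the difference is a real combination of active constraints and
    equations. An active constraint is at most the active sum, as the other summands lie in [M];
    multiples of equations lie in [M] with both signs. *)
Lemma active_sum_dominates v i : vertex (hrep_set r) v ->
  dominated C M (active_sum v) (y i 0 - C (v i 0)).
Proof.
move=> vV; have [s [t [s0 E]]] := vertex_active_span vV i.
have [/hrep_setP[_ Bv] _] := vV; have aM := active_sum_mem v.
have -> : y i 0 - C (v i 0) =
    - (\sum_j C (s 0 j) * ineq_at j + \sum_j C (t 0 j) * eq_at j).
  have subE (P Q : 'M[A]_1) : (P - Q) 0 0 = P 0 0 - Q 0 0 by rewrite !mxE.
  rewrite -row_combination -E subE opprB map_delta_mx -rowE [in RHS]mxE.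
  congr (_ - _); rewrite mxE; congr (C _).
  have -> : v i 0 = ((delta_mx 0 i : 'rV[R]_k) *m v) 0 0 by rewrite -rowE mxE.
  rewrite E mulmxDl -!mulmxA Bv mxE [RHS]mxE; congr (_ + _).
  rewrite !mxE; apply: eq_bigr => j _.
  by have [/eqP <-//|/s0 ->] := boolP (active r v j); rewrite !mul0r.
apply: dominatedN.
apply: dominatedD => //; apply: dominated_sum => // j.
  have [vj|/s0 ->] := boolP (active r v j); last first.
    by rewrite rmorph0 mul0r; apply: dominated0.
  apply: dominatedZ => //; apply: (@dominated_le _ _ C _ _ SM aM _ (active_sum v)) => //.
    exact: dominated_unit.
  by rewrite /active_sum (bigD1 j) //= addrAC subrr add0r; apply: sumM.
exists 0; rewrite rmorph0 mul0r sub0r add0r -mulNr; by split.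
Qed.

End Certificates.

(** * Evaluation and derivatives of affine and bilinear expressions *)

Lemma bilin_morph (S T : comNzRingType) (f : {rmorphism S -> T}) (d q : nat)
    (B : 'M[S]_(q, d)) (b : 'cV[S]_q) (x : 'cV[S]_d) (z : 'cV[S]_q) :
  f (bilin B b x z) = bilin (map_mx f B) (map_mx f b) (map_mx f x) (map_mx f z).
Proof. by rewrite /bilin map_trmx -map_mxM -map_mxB -map_mxM [RHS]mxE. Qed.

Lemma bilin_addl (R : comNzRingType) (d q : nat) (B : 'M[R]_(q, d)) (b : 'cV[R]_q) x xi z t :
  bilin B b (x + t *: xi) z = bilin B b x z + t * - (z^T *m (B *m xi)) 0 0.
Proof.
rewrite /bilin [B *m (_ + _)]mulmxDr -scalemxAr opprD addrA mulmxDr mulmxN -scalemxAr.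
by rewrite mxE [X in _ + X]mxE [X in _ - X]mxE mulrN.
Qed.

Lemma bilin_addr (R : comNzRingType) (d q : nat) (B : 'M[R]_(q, d)) (b : 'cV[R]_q) x z ze t :
  bilin B b x (z + t *: ze) = bilin B b x z + t * (ze^T *m (b - B *m x)) 0 0.
Proof.
have tE : (z + t *: ze)^T = z^T + t *: ze^T by apply/matrixP => i j; rewrite !mxE.
by rewrite /bilin tE mulmxDl -scalemxAl mxE [X in _ + X]mxE.
Qed.

Section DerivationMatrices.
Variables (R : realType) (N : nat) (A : comNzRingType) (C : {rmorphism R -> A}).
Variables (ev : ('I_N -> R) -> {rmorphism A -> R}).
Hypothesis evC : forall x r, ev x (C r) = r.
Variables (x0 : 'I_N -> R) (psi : A -> R).
Hypothesis psiP : point_derivation C ev x0 psi.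

Lemma derivationD a b : psi (a + b) = psi a + psi b.
Proof. by case: psiP. Qed.

Lemma derivationC r : psi (C r) = 0.
Proof. by case: psiP. Qed.

Lemma derivationM a b : psi (a * b) = ev x0 a * psi b + psi a * ev x0 b.
Proof. by case: psiP. Qed.

Lemma derivationZ r a : psi (C r * a) = r * psi a.
Proof. by rewrite derivationM evC derivationC mul0r addr0. Qed.

Lemma derivationN a : psi (- a) = - psi a.
Proof. by rewrite -mulN1r -[-1](rmorphN1 C) derivationZ mulN1r. Qed.

Lemma derivation_sum (I : finType) (F : I -> A) : psi (\sum_i F i) = \sum_i psi (F i).
Proof.
apply: (big_morph psi derivationD); by rewrite -(rmorph0 C) derivationC.
Qed.

Lemma derivation_affine (k m : nat) (P : 'M[R]_(m, k)) (a : 'cV[R]_m) (y : 'cV[A]_k) j :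
  psi ((map_mx C a - map_mx C P *m y) j 0) = - (P *m map_mx psi y) j 0.
Proof.
rewrite !mxE derivationD derivationC add0r derivationN derivation_sum; congr (- _).
by apply: eq_bigr => i _; rewrite !mxE derivationZ.
Qed.

Lemma ev_affine (k m : nat) (P : 'M[R]_(m, k)) (a : 'cV[R]_m) (y : 'cV[A]_k) x j :
  ev x ((map_mx C a - map_mx C P *m y) j 0) = (a - P *m map_mx (ev x) y) j 0.
Proof.
have idC (p l : nat) (Q : 'M[R]_(p, l)) : map_mx (ev x) (map_mx C Q) = Q.
  by apply/matrixP => i i'; rewrite !mxE evC.
transitivity ((map_mx (ev x) (map_mx C a - map_mx C P *m y)) j 0); first by rewrite [RHS]mxE.
by rewrite map_mxB map_mxM !idC.
Qed.

Lemma ev_bilin (d q : nat) (B : 'M[R]_(q, d)) (b : 'cV[R]_q) (y : 'cV[A]_d)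
    (z : 'cV[A]_q) x :
  ev x (bilin (map_mx C B) (map_mx C b) y z) = bilin B b (map_mx (ev x) y) (map_mx (ev x) z).
Proof.
have idC (p l : nat) (Q : 'M[R]_(p, l)) : map_mx (ev x) (map_mx C Q) = Q.
  by apply/matrixP => i i'; rewrite !mxE evC.
by rewrite bilin_morph !idC.
Qed.

Lemma derivation_bilin (d q : nat) (B : 'M[R]_(q, d)) (b : 'cV[R]_q) (y : 'cV[A]_d)
    (z : 'cV[A]_q) :
  psi (bilin (map_mx C B) (map_mx C b) y z) =
    - ((map_mx (ev x0) z)^T *m (B *m map_mx psi y)) 0 0 +
    ((map_mx psi z)^T *m (b - B *m map_mx (ev x0) y)) 0 0.
Proof.
rewrite /bilin mxE derivation_sum [(_ *m (B *m _)) 0 0]mxE.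
rewrite [(_ *m (b - _)) 0 0]mxE -sumrN -big_split /=.
apply: eq_bigr => j _; rewrite derivationM derivation_affine ev_affine.
by rewrite !mxE mulrN.
Qed.

End DerivationMatrices.

(** * The bilinear form on a product of two polytopes *)

Section ProductProgram.
Variables (R : realType) (d q : nat) (A : comNzRingType) (C : {rmorphism R -> A}).
Variables (X_ : 'I_(d + q) -> A) (ev : ('I_(d + q) -> R) -> {rmorphism A -> R}).
Hypothesis evC : forall x r, ev x (C r) = r.
Hypothesis evX : forall x i, ev x (X_ i) = x i.
Hypothesis gen_ind : forall P : A -> Prop,
  (forall r, P (C r)) -> (forall i, P (X_ i)) ->
  (forall a b, P a -> P b -> P (a + b)) ->
  (forall a b, P a -> P b -> P (a * b)) -> forall a, P a.
Variables (m1 n1 m2 n2 : nat) (r1 : hrep R d m1 n1) (r2 : hrep R q m2 n2).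
Variables (B : 'M[R]_(q, d)) (b : 'cV[R]_q).

Let y : 'cV[A]_d := \col_i X_ (lshift q i).
Let z : 'cV[A]_q := \col_j X_ (rshift d j).

Definition product_ineq (i : 'I_m1 + 'I_m2) : A :=
  match i with inl j => ineq_at C r1 y j | inr j => ineq_at C r2 z j end.
Definition product_eq (i : 'I_n1 + 'I_n2) : A :=
  match i with inl j => eq_at C r1 y j | inr j => eq_at C r2 z j end.

Local Notation M := (generated_module product_ineq product_eq).

Definition pair_point (vw : 'cV[R]_d * 'cV[R]_q) (i : 'I_(d + q)) : R :=
  match split i with inl j => vw.1 j 0 | inr j => vw.2 j 0 end.

Lemma point_lshift vw i : pair_point vw (lshift q i) = vw.1 i 0.
Proof. by rewrite /pair_point (unsplitK (inl i)). Qed.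

Lemma point_rshift vw i : pair_point vw (rshift d i) = vw.2 i 0.
Proof. by rewrite /pair_point (unsplitK (inr i)). Qed.

Lemma ev_point_y vw : map_mx (ev (pair_point vw)) y = vw.1.
Proof. by apply/colP => i; rewrite !mxE evX point_lshift. Qed.

Lemma ev_point_z vw : map_mx (ev (pair_point vw)) z = vw.2.
Proof. by apply/colP => i; rewrite !mxE evX point_rshift. Qed.

Lemma hrep_set_ev (k m n : nat) (r : hrep R k m n) (t : 'cV[A]_k) x :
  (forall j, 0 <= ev x (ineq_at C r t j)) -> (forall j, ev x (eq_at C r t j) = 0) ->
  hrep_set r (map_mx (ev x) t).
Proof.
move=> Hi He; apply/hrep_setP; split=> [j|].
  by have := Hi j; rewrite /ineq_at (ev_affine evC) !mxE subr_ge0.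
apply/colP => j; have /eqP := He j.
by rewrite /eq_at (ev_affine evC) !mxE subr_eq0 => /eqP ->.
Qed.

Lemma ev_hrep_set (k m n : nat) (r : hrep R k m n) (t : 'cV[A]_k) x :
  hrep_set r (map_mx (ev x) t) ->
  (forall j, 0 <= ev x (ineq_at C r t j)) /\ (forall j, ev x (eq_at C r t j) = 0).
Proof.
move=> /hrep_setP[Hi He]; split=> j.
  by rewrite /ineq_at (ev_affine evC) mxE [X in _ + X]mxE subr_ge0.
by rewrite /eq_at (ev_affine evC) He subrr mxE.
Qed.

Lemma product_module_ge0 vw a : hrep_set r1 vw.1 -> hrep_set r2 vw.2 -> M a ->
  0 <= ev (pair_point vw) a.
Proof.
rewrite -{1}(ev_point_y vw) -{1}(ev_point_z vw).
move=> /ev_hrep_set[H1 E1] /ev_hrep_set[H2 E2].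
by apply: generated_module_ge0 => [[j|j]|[j|j]] /=.
Qed.

(** Both signs of each equation lie in [M], so nonnegativity on [M] forces the equations as well as
    the inequalities. *)
Lemma module_point x : (forall m, M m -> 0 <= ev x m) -> exists vw,
  [/\ hrep_set r1 vw.1, hrep_set r2 vw.2 & forall i, x i = pair_point vw i].
Proof.
move=> Hx; exists (map_mx (ev x) y, map_mx (ev x) z).
have H0 j : ev x (product_eq j) = 0.
  apply/eqP; rewrite eq_le; apply/andP; split; last first.
    by rewrite -[product_eq j]mul1r; apply/Hx/generated_module_eq.
  by rewrite -oppr_ge0 -rmorphN -mulN1r; apply/Hx/generated_module_eq.
split=> /= [||i].
- apply: hrep_set_ev => j; last exact: (H0 (inl j)).
  exact: (Hx _ (generated_module_ineq _ _ (inl j))).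
- apply: hrep_set_ev => j; last exact: (H0 (inr j)).
  exact: (Hx _ (generated_module_ineq _ _ (inr j))).
- by case: (split_ordP i) => j ->; rewrite ?point_lshift ?point_rshift !mxE evX.
Qed.

Section Certificate.
Hypotheses (r1_nonempty : hrep_set r1 !=set0) (r1_bounded : bounded (hrep_set r1)).
Hypotheses (r2_nonempty : hrep_set r2 !=set0) (r2_bounded : bounded (hrep_set r2)).
Hypothesis bilin_ge0 : forall v w, hrep_set r1 v -> hrep_set r2 w -> 0 <= bilin B b v w.
Hypothesis zero_vertex : forall v w, hrep_set r1 v -> hrep_set r2 w ->
  bilin B b v w = 0 -> vertex (hrep_set r1) v /\ vertex (hrep_set r2) w.

Let p : A := bilin (map_mx C B) (map_mx C b) y z.

Let MQ : quadratic_module M. Proof. exact: generated_module_quadratic. Qed.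
Let SM : square_module M. Proof. by case: MQ. Qed.

Let ineqM1 j : M (ineq_at C r1 y j).
Proof. exact: (generated_module_ineq _ _ (inl j)). Qed.
Let ineqM2 j : M (ineq_at C r2 z j).
Proof. exact: (generated_module_ineq _ _ (inr j)). Qed.
Let eqM1 f j : M (f * eq_at C r1 y j).
Proof. exact: (generated_module_eq _ _ f (inl j)). Qed.
Let eqM2 f j : M (f * eq_at C r2 z j).
Proof. exact: (generated_module_eq _ _ f (inr j)). Qed.

Definition is_zero (vw : 'cV[R]_d * 'cV[R]_q) : Prop :=
  [/\ hrep_set r1 vw.1, hrep_set r2 vw.2 & bilin B b vw.1 vw.2 = 0].

Lemma zeros_finite : exists s : seq ('cV[R]_d * 'cV[R]_q),
  uniq s /\ forall vw, vw \in s <-> is_zero vw.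
Proof.
have [s1 H1] := vertices_finite r1; have [s2 H2] := vertices_finite r2.
exists (undup [seq vw <- [seq (v, w) | v <- s1, w <- s2] | `[< is_zero vw >]]).
split; first exact: undup_uniq.
move=> [v w]; rewrite mem_undup mem_filter; split; first by move=> /andP[/asboolP].
move=> Z; apply/andP; split; first exact/asboolP.
have [/= S1 S2 Z0] := Z; have [V1 V2] := zero_vertex S1 S2 Z0.
by apply: allpairs_f; [apply: H1|apply: H2].
Qed.

Lemma zero_derivation vw psi i : is_zero vw ->
  point_derivation C ev (pair_point vw) psi ->
  (forall m, M m -> ev (pair_point vw) m = 0 -> 0 <= psi m) -> psi p <= 0 ->
  psi (X_ i) = 0.
Proof.
move=> [S1 S2 Z0] psiP psi0 psip.
have [V1 V2] := zero_vertex S1 S2 Z0.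
(* The derivation sends a constraint (a - A t)_j to - (A psi(t))_j. Its nonnegativity on active
   constraints and on both signs of the equations thus makes the vector psi(t) a feasible
   direction. *)
have dir (k m n : nat) (r : hrep R k m n) (t : 'cV[A]_k) v :
    (forall j, M (ineq_at C r t j)) -> (forall f j, M (f * eq_at C r t j)) ->
    map_mx (ev (pair_point vw)) t = v -> hrep_set r v ->
    exists e : R, 0 < e /\ forall s, 0 <= s -> s <= e -> hrep_set r (v + s *: map_mx psi t).
  move=> iM eM tv Sv; have [_ Bv] := (hrep_setP r v).1 Sv.
  apply: feasible_direction => // [j vj|].
    rewrite -oppr_ge0 -(derivation_affine evC psiP (ineq_mx r) (ineq_rhs r)).
    apply: (psi0 _ (iM j)); rewrite /ineq_at (ev_affine evC) tv mxE [X in _ + X]mxE.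
    by move/eqP: vj => ->; rewrite subrr.
  apply/colP => j; rewrite [RHS]mxE.
  have ev_eq : ev (pair_point vw) (eq_at C r t j) = 0.
    by rewrite /eq_at (ev_affine evC) tv Bv subrr mxE.
  apply/eqP; rewrite -oppr_eq0 -(derivation_affine evC psiP (Defs.eq_mx r) (eq_rhs r)).
  rewrite -/(eq_at C r t j).
  rewrite eq_le -oppr_ge0 -(derivationN evC psiP); apply/andP; split.
    by apply: psi0; rewrite ?rmorphN ?ev_eq ?oppr0 // -mulN1r; exact: eM.
  by apply: (psi0 _ _ ev_eq); rewrite -[eq_at _ _ _ _]mul1r; exact: eM.
have [e1 [e10 D1]] := dir _ _ _ _ _ _ ineqM1 eqM1 (ev_point_y vw) S1.
have [e2 [e20 D2]] := dir _ _ _ _ _ _ ineqM2 eqM2 (ev_point_z vw) S2.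
move: psip; rewrite /p (derivation_bilin evC psiP) ev_point_y ev_point_z.
(* The form is nonnegative along each of the two segments, so both partial derivatives are
   nonnegative. Their sum is [psi p <= 0], hence both are 0. *)
have G1 s : 0 <= s -> s <= e1 -> 0 <= s * - (vw.2^T *m (B *m map_mx psi y)) 0 0.
  by move=> s0 se; have := bilin_ge0 (D1 _ s0 se) S2; rewrite bilin_addl Z0 add0r.
have G2 s : 0 <= s -> s <= e2 -> 0 <= s * ((map_mx psi z)^T *m (b - B *m vw.1)) 0 0.
  by move=> s0 se; have := bilin_ge0 S1 (D2 _ s0 se); rewrite bilin_addr Z0 add0r.
have := G2 _ (ltW e20) (lexx _); have := G1 _ (ltW e10) (lexx _).
rewrite !pmulr_rge0 // => H1 H2 H.
have {}H1 : - (vw.2^T *m (B *m map_mx psi y)) 0 0 = 0.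
  by apply/eqP; rewrite eq_le H1 andbT; apply: le_trans H; rewrite lerDl.
have {}H2 : ((map_mx psi z)^T *m (b - B *m vw.1)) 0 0 = 0.
  by apply/eqP; rewrite eq_le H2 andbT; apply: le_trans H; rewrite lerDr H1.
(* The vertex at parameter [e / 2] is the midpoint of the points at 0 and [e], so the segment
   degenerates. *)
have null (k : nat) (S : set 'cV[R]_k) v xi (e : R) : 0 < e ->
    (forall s, 0 <= s -> s <= e -> S (v + s *: xi)) ->
    vertex S (v + (e / 2) *: xi) -> xi = 0.
  move=> e0 De Ve; have e2' : 0 < e / 2 by rewrite divr_gt0.
  have : (e / 2) *: xi = 0.
    apply: (vertex_not_midpoint Ve).
      by rewrite -addrA -scalerDl -splitr; apply: De => //; apply: ltW.
    by rewrite addrK -[v]addr0 -(scale0r xi); apply: De => //; apply: ltW.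
  by move=> /eqP; rewrite scaler_eq0 gt_eqF //= => /eqP.
have half (e : R) : 0 < e -> 0 <= e / 2 /\ e / 2 <= e.
  by move=> e0; split; lra.
have xi0 : map_mx psi y = 0.
  apply: (null _ _ _ _ _ e10 D1); have [h0 h1] := half _ e10.
  by apply: (zero_vertex (D1 _ h0 h1) S2 _).1; rewrite bilin_addl Z0 H1 mulr0 addr0.
have ze0 : map_mx psi z = 0.
  apply: (null _ _ _ _ _ e20 D2); have [h0 h1] := half _ e20.
  by apply: (zero_vertex S1 (D2 _ h0 h1) _).2; rewrite bilin_addr Z0 H2 mulr0 addr0.
case: (split_ordP i) => j ->.
  by have /colP/(_ j) := xi0; rewrite !mxE.
by have /colP/(_ j) := ze0; rewrite !mxE.
Qed.

Theorem bilin_membership : M p.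
Proof.
have [s [s_uniq s_zero]] := zeros_finite.
pose X (k : 'I_(size s)) := pair_point (tnth (in_tuple s) k).
have Xz k : is_zero (tnth (in_tuple s) k) by apply/s_zero; apply: mem_tnth.
pose g (k : 'I_(size s)) := active_sum C r1 y (tnth (in_tuple s) k).1 +
  active_sum C r2 z (tnth (in_tuple s) k).2.
have aM1 v : M (active_sum C r1 y v) by apply: active_sum_mem.
have aM2 v : M (active_sum C r2 z v) by apply: active_sum_mem.
apply: (@membership R (d + q) A C X_ ev evC evX gen_ind M MQ (size s) X g).
- move=> k l kl; apply: contrapT => nX; move/eqP: kl; apply; apply/val_inj.
  have XE i : X k i = X l i.
    by apply: contrapT => /eqP H; apply: nX; exists i.
  have : tnth (in_tuple s) k = tnth (in_tuple s) l.
    rewrite [LHS]surjective_pairing [RHS]surjective_pairing; congr pair.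
      by apply/colP => i; have := XE (lshift q i); rewrite /X !point_lshift.
    by apply/colP => i; have := XE (rshift d i); rewrite /X !point_rshift.
  by rewrite !(tnth_nth (0, 0)) => /eqP; rewrite nth_uniq // => /eqP.
- move=> i; case: (split_ordP i) => j ->.
    have -> : X_ (lshift q j) = y j 0 by rewrite mxE.
    exact: (coordinate_dominated MQ ineqM1 eqM1).
  have -> : X_ (rshift d j) = z j 0 by rewrite mxE.
  exact: (coordinate_dominated MQ ineqM2 eqM2).
- by move=> k; apply: SM.1.
- move=> k; rewrite rmorphD !rmorph_sum !big1 ?addr0 // => j /eqP jE;
    rewrite /= /ineq_at (ev_affine evC) ?ev_point_y ?ev_point_z mxE [X in _ + X]mxE jE;
    exact: subrr.
- move=> k i; have [S1 S2 Z0] := Xz k; have [V1 V2] := zero_vertex S1 S2 Z0.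
  case: (split_ordP i) => j ->.
    have -> : X_ (lshift q j) = y j 0 by rewrite mxE.
    rewrite /X point_lshift.
    apply: (dominated_trans MQ _ (active_sum_dominates MQ ineqM1 eqM1 j V1)) => //.
    by rewrite /g addrAC subrr add0r.
  have -> : X_ (rshift d j) = z j 0 by rewrite mxE.
  rewrite /X point_rshift.
  apply: (dominated_trans MQ _ (active_sum_dominates MQ ineqM2 eqM2 j V2)) => //.
  by rewrite /g addrK.
- by move=> k; rewrite (ev_bilin evC) ev_point_y ev_point_z; have [_ _] := Xz k.
- move=> x /module_point[vw [S1 S2 xE]] px.
  have : vw \in s.
    apply/s_zero; split=> //; apply/eqP; rewrite eq_le bilin_ge0 // andbT.
    have -> : bilin B b vw.1 vw.2 = ev x p.
      rewrite (ev_bilin evC) -[in LHS](ev_point_y vw) -[in LHS](ev_point_z vw).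
      by congr bilin; apply/colP => i; rewrite !mxE !evX xE.
    exact: px.
  move=> /(nthP vw)[k ks kE]; exists (Ordinal ks) => i; rewrite xE /X.
  by rewrite (tnth_nth vw) /= kE.
- by move=> k psi psiP psi0 psip i; apply: (zero_derivation i (Xz k) psiP).
Qed.

End Certificate.
End ProductProgram.

(** * Farkas duality between the projection and the bilinear form *)

Section Projection.
Variables (R : realType) (d n q : nat).
Variables (B : 'M[R]_(q, d)) (B' : 'M[R]_(q, n)) (b : 'cV[R]_q).

(** As [z] annihilates [B'], the term [B' *m y'] may be inserted, and the form pairs a nonnegative
    [z] with nonnegative slacks. *)
Lemma projection_bilin_ge0 x z : proj (lifted_polyhedron B B' b) x ->
  dual_polytope B' z -> 0 <= bilin B b x z.
Proof.
move=> [y' Qy] [/= Bz [_ z0]].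
have -> : bilin B b x z = (z^T *m (b - (B *m x + B' *m y'))) 0 0.
  rewrite /bilin opprD addrA [in RHS]mulmxDr mulmxN mulmxA.
  by rewrite -[z^T *m B']trmxK trmx_mul trmxK Bz trmx0 mul0mx subr0.
rewrite mxE sumr_ge0 // => i _; rewrite mxE mulr_ge0 //.
  by have := z0 i; rewrite mxE.
by rewrite mxE [X in _ + X]mxE subr_ge0; apply: Qy.
Qed.

(** If B' y' <= c has no solution for c = b - B x, its homogenization forces [y.2 <= 0], and Farkas
    gives v >= 0 with v^T B' = 0 and v^T c = -1. This v is nonzero, so it scales into the simplex,
    where the form is then negative. *)
Lemma bilin_ge0_projection x : (forall z, dual_polytope B' z -> 0 <= bilin B b x z) ->
  proj (lifted_polyhedron B B' b) x.
Proof.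
move=> Hz; apply: contrapT => nx.
pose W := ('cV[R]_n * R^o)%type; pose c := b - B *m x.
have [||y Hy|v [v0 E]] := @farkas R W 'I_q
  (fun i y => (B' *m y.1) i 0 - c i 0 * y.2) (fun y => y.2 : R).
- by move=> i; apply: functional_comb => // t y y'; exact: functional_mx.
- by [].
- rewrite leNgt; apply/negP => y0; apply: nx; exists (y.2^-1 *: y.1) => i.
  have := Hy i; rewrite subr_le0 => Hi.
  rewrite mxE addrC -lerBrDr -scalemxAr mxE ler_pdivrMl // mulrC.
  by apply: le_trans Hi _; rewrite /c !mxE.
pose z := \col_i v i.
have zB : z^T *m B' = 0.
  apply: row_ext => y; have := E (y, 0) => /= E0; rewrite mul0mx [RHS]mxE.
  rewrite -mulmxA mxE [RHS]E0; apply: eq_bigr => i _.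
  by rewrite !mxE mulr0 subr0.
have zc : (z^T *m c) 0 0 = -1.
  have := E (0, 1) => /= ->; rewrite mxE -sumrN; apply: eq_bigr => i _.
  by rewrite mulmx0 mulr1 !mxE sub0r mulrN opprK.
have sv : 0 < \sum_i v i.
  rewrite lt_neqAle sumr_ge0 // andbT; apply/eqP => s0.
  have z0 i : v i = 0.
    apply/eqP; have /eqP := esym s0; rewrite psumr_eq0 // => /allP; apply.
    by rewrite mem_index_enum.
  move: zc; rewrite mxE big1 => [/esym/eqP|i _]; first by rewrite oppr_eq0 oner_eq0.
  by rewrite !mxE z0 mul0r.
have := Hz ((\sum_i v i)^-1 *: z).
have -> : bilin B b x ((\sum_i v i)^-1 *: z) = - (\sum_i v i)^-1.
  rewrite /bilin -/c; have -> : ((\sum_i v i)^-1 *: z)^T = (\sum_i v i)^-1 *: z^T.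
    by apply/matrixP => i j; rewrite !mxE.
  by rewrite -scalemxAl mxE zc mulrN1.
suff Kz : dual_polytope B' ((\sum_i v i)^-1 *: z).
  by move=> /(_ Kz); rewrite oppr_ge0 leNgt invr_gt0 sv.
split => /=.
  by rewrite -scalemxAr -[B'^T *m z]trmxK trmx_mul trmxK zB trmx0 scaler0.
split.
  apply/matrixP => i j; rewrite !ord1 mxE [RHS]mxE eqxx mulr1n.
  rewrite -[RHS](mulVf (lt0r_neq0 sv)) mulr_sumr; apply: eq_bigr => k _.
  by rewrite !mxE mul1r.
by move=> i; rewrite !mxE mulr_ge0 // invr_ge0 ltW.
Qed.

Lemma dual_polytope_bounded : bounded (dual_polytope B').
Proof.
exists 1 => z [_ [s1 z0]] i.
have zi j : 0 <= z j 0 by have := z0 j; rewrite mxE.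
rewrite ger0_norm //.
have <- : \sum_j z j 0 = 1.
  have /matrixP/(_ 0 0) := s1; rewrite mxE [RHS]mxE eqxx mulr1n => <-.
  by apply: eq_bigr => j _; rewrite mxE mul1r.
by rewrite (bigD1 i) //= lerDl sumr_ge0.
Qed.

End Projection.

(** * Passage between the truncated and the untruncated module *)

Section Truncation.
Variables (R : realType) (d q m1 n1 m2 n2 : nat).
Variables (r1 : hrep R d m1 n1) (r2 : hrep R q m2 n2).

Local Notation A := {mpoly R[d + q]}.
Local Notation C := (@mpolyC (d + q) R : {rmorphism R -> A}).
Local Notation X_ := (fun i : 'I_(d + q) => 'X_i : A).
Local Notation M := (generated_module (product_ineq C X_ r1 r2) (product_eq C X_ r1 r2)).

Lemma truncated_generated t g h : qmodule r1 r2 t g -> trunc_ideal r1 r2 t h ->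
  M (g + h).
Proof.
move=> [s0 [s1 [s2 [[_ S0] S1 S2 ->]]]] [t1 [t2 [_ _ ->]]].
exists s0, (fun i => match i with inl j => s1 j | inr j => s2 j end),
  (fun i => match i with inl j => t1 j | inr j => t2 j end); split => //.
  by move=> [j|j]; [have [] := S1 j|have [] := S2 j].
rewrite !big_sumType /= !addrA; congr (_ + _ + _ + _ + _).
Qed.

Lemma generated_truncated a : M a -> exists t0, (2 <= t0)%N /\
  forall t, (t0 <= t)%N -> exists g h,
    [/\ qmodule r1 r2 t g, trunc_ideal r1 r2 t h & a = g + h].
Proof.
move=> [s0 [s [t [S0 Ss aE]]]].
(* [D] bounds the size of every multiplier. A level of at least [D.+2] makes all degree bounds
   exceed it and also secures [2 <= t0]. *)
pose D := (msize s0 + \sum_i msize (s i) + \sum_j msize (t j))%N.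
exists D.+2; split=> // k Dk.
have Hs i : (msize (s i) <= D)%N.
  by rewrite /D (bigD1 i) //=; lia.
have Ht j : (msize (t j) <= D)%N.
  by rewrite /D (bigD1 j) //=; lia.
have H0 : (msize s0 <= D)%N by rewrite /D; lia.
move: D Dk Hs Ht H0 => D Dk Hs Ht H0.
exists (s0 + \sum_j s (inl j) * ineq_poly r1 (xvar R d q) j 0
           + \sum_j s (inr j) * ineq_poly r2 (zvar R d q) j 0),
  (\sum_j t (inl j) * Defs.eq_poly r1 (xvar R d q) j 0
             + \sum_j t (inr j) * Defs.eq_poly r2 (zvar R d q) j 0); split.
- exists s0, (fun j => s (inl j)), (fun j => s (inr j)); split => //.
  + by split => //; apply: leq_trans H0 _; lia.
  + by move=> j; split; [apply: leq_trans (Hs _) _; lia|apply: Ss].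
  + by move=> j; split; [apply: leq_trans (Hs _) _; lia|apply: Ss].
- exists (fun j => t (inl j)), (fun j => t (inr j)); split => // j.
  + by apply: leq_trans (Ht _) _; lia.
  + by apply: leq_trans (Ht _) _; lia.
- by rewrite aE !big_sumType /= !addrA.
Qed.

End Truncation.

(** * Deciding the containment *)

Theorem theorem4p2 (R : realType) (d n q m m1 n1 m2 n2 : nat)
  (A : 'M[R]_(m, d)) (a : 'cV[R]_m)
  (B : 'M[R]_(q, d)) (B' : 'M[R]_(q, n)) (b : 'cV[R]_q)
  (r1 : hrep R d m1 n1) (r2 : hrep R q m2 n2)
  (P_bounded : bounded (polyhedron A a))
  (P_nonempty : polyhedron A a !=set0)
  (Q_nonempty : lifted_polyhedron B B' b !=set0)
  (K_nonempty : dual_polytope B' !=set0)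
  (r1_P : hrep_set r1 = polyhedron A a)
  (r2_K : hrep_set r2 = dual_polytope B')
  (r1_standing : hrep_standing r1)
  (r2_standing : hrep_standing r2)
  (optimal_vertex : forall (x : 'cV[R]_d) (z : 'cV[R]_q),
     bilin_optimal B b (polyhedron A a) (dual_polytope B') x z ->
     vertex (polyhedron A a) x /\ vertex (dual_polytope B') z) :
  exists t0 : nat, (2 <= t0)%N /\
    forall t : nat, (t0 <= t)%N ->
      (polyhedron A a `<=` proj (lifted_polyhedron B B' b) <->
       (sos_value r1 r2 (bilin_poly B b) t <= 0)%E).
Proof.
pose Ap := {mpoly R[d + q]}.
pose C : {rmorphism R -> Ap} := @mpolyC (d + q) R.
pose X_ (i : 'I_(d + q)) : Ap := 'X_i.
pose ev (x : 'I_(d + q) -> R) : {rmorphism Ap -> R} := meval x.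
have evC x r : ev x (C r) = r by exact: mevalC.
have evX x i : ev x (X_ i) = x i by exact: mevalXU.
have gen_ind : forall P : Ap -> Prop,
  (forall r, P (C r)) -> (forall i, P (X_ i)) ->
  (forall a b, P a -> P b -> P (a + b)) ->
  (forall a b, P a -> P b -> P (a * b)) -> forall a, P a by exact: mpoly_gen_ind.
pose p : Ap := bilin (map_mx C B) (map_mx C b) (\col_i X_ (lshift q i)) (\col_j X_ (rshift d j)).
have fE : bilin_poly B b = - p by [].
have evp (v : 'cV[R]_d) (w : 'cV[R]_q) : ev (pair_point (v, w)) p = bilin B b v w.
  by rewrite /p (ev_bilin evC) (ev_point_y evX) (ev_point_z evX).
(* At every level a feasible mu bounds f from above on P x K, so a negative value of the form would
   make the hierarchy value positive. *)
have sound t : (sos_value r1 r2 (bilin_poly B b) t <= 0)%E ->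
    polyhedron A a `<=` proj (lifted_polyhedron B B' b).
  move=> ft x Px; apply: bilin_ge0_projection => z Kz.
  rewrite leNgt; apply/negP => neg.
  have : ((- bilin B b x z)%:E <= sos_value r1 r2 (bilin_poly B b) t)%E.
    apply: le_ereal_inf_tmp => _ [mu [g [h [Hg Hh E]]] <-].
    rewrite lee_fin -subr_ge0 opprK.
    have := truncated_generated Hg Hh; rewrite -E => Mp.
    have := @product_module_ge0 R d q Ap C X_ ev evC evX m1 n1 m2 n2 r1 r2 (x, z) _ _ _ Mp.
    rewrite fE opprK rmorphD evp evC; apply; by rewrite ?r1_P ?r2_K.
  move=> /le_trans/(_ ft); rewrite lee_fin oppr_le0 leNgt neg //.
have [contained|not_contained] :=
    pselect (polyhedron A a `<=` proj (lifted_polyhedron B B' b)); last first.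
  (* Without containment both sides of the equivalence fail at all levels. *)
  by exists 2%N; split=> // t _; split=> [//|/sound].
have bilin_ge0 (v : 'cV[R]_d) (w : 'cV[R]_q) : hrep_set r1 v -> hrep_set r2 w -> 0 <= bilin B b v w.
  rewrite r1_P r2_K => Pv Kw; apply: projection_bilin_ge0 Kw; exact: contained.
have zero_vertex (v : 'cV[R]_d) (w : 'cV[R]_q) : hrep_set r1 v ->
    hrep_set r2 w -> bilin B b v w = 0 ->
    vertex (hrep_set r1) v /\ vertex (hrep_set r2) w.
  (* The form is nonnegative on P x K, so any zero is an optimal solution. *)
  move=> S1 S2 Z; rewrite r1_P r2_K; apply: optimal_vertex; split.
  - by rewrite -r1_P.
  - by rewrite -r2_K.
  - by move=> x' z'; rewrite -r1_P -r2_K Z; apply: bilin_ge0.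
have Mp := @bilin_membership R d q Ap C X_ ev evC evX gen_ind m1 n1 m2 n2 r1 r2 B b.
have {}Mp : generated_module (product_ineq C X_ r1 r2) (product_eq C X_ r1 r2) p.
  apply: Mp => //; rewrite ?r1_P ?r2_K //; exact: dual_polytope_bounded.
have [t0 [t02 Ht]] := generated_truncated Mp.
exists t0; split=> // t /Ht[g [h [Hg Hh E]]]; split=> [_|/sound //].
(* Since 0 - f = p, the certificate of [p] makes mu = 0 feasible. *)
apply: ereal_inf_lbound; exists 0 => //; exists g, h; split=> //.
by rewrite fE opprK mpolyC0 add0r.
Qed.
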